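(* Suppose $m=2$ and $w=(1-t,t)$ for some $t\in(0,1)$. For $A_1,A_2\in\mathrm{UT}_n$, the $w$-weighted Karcher mean $G(w;A_1,A_2)$ exists uniquely and depends analytically on the entries of $A_1$ and $A_2$. More precisely, $$G(w;A_1,A_2)=A_1^{1/2}\bigl(A_1^{-1/2}A_2A_1^{-1/2}\bigr)^tA_1^{1/2}=A_1(A_1^{-1}A_2)^t=(A_2A_1^{-1})^tA_1.$$ Moreover, denoting $A_1\#_tA_2:=G((1-t,t);A_1,A_2)$, one has $$A_1\#_tA_2=A_2\#_{1-t}A_1.$$
   Context: $\mathrm{UT}_n$ is the Lie group of $n\times n$ real upper triangular matrices with positive diagonal entries; $\log:\mathrm{UT}_n\to\mathfrak{ut}_n$ is the inverse of the matrix exponential $\exp:\mathfrak{ut}_n\to\mathrm{UT}_n$ (an analytic diffeomorphism), where $\mathfrak{ut}_n$ is the space of real upper triangular $n\times n$ matrices, and $A^{s}=\exp(s\log A)$ for $A\in\mathrm{UT}_n$, $s\in\mathbb{R}$. A $w$-weighted Karcher mean of $(A_1,\ldots,A_m)\in(\mathrm{UT}_n)^m$, for positive weights $w=(w_1,\ldots,w_m)$ summing to $1$, is a solution $X\in\mathrm{UT}_n$ of $\sum_{i=1}^m w_i\log(X^{-1}A_i)=0$, written $X=G(w;A_1,\ldots,A_m)$. *)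

(* Defs.v *)
From HB Require Import structures.
From mathcomp Require Import all_boot all_order all_algebra finmap.
From mathcomp Require Import all_classical all_reals all_analysis.
From mathcomp.analysis.showcase Require Import summability.

Set Implicit Arguments.
Unset Strict Implicit.
Unset Printing Implicit Defensive.

Import Order.TTheory GRing.Theory Num.Theory numFieldNormedType.Exports.
Local Open Scope classical_set_scope.
Local Open Scope ring_scope.

Section UpperTriangular.
Variables (R : realType) (n : nat).
Implicit Types (A X : 'M[R]_n).

(* MathComp's [is_trig_mx] is lower triangularity. *)
Definition ut : set 'M[R]_n := [set A | is_trig_mx A^T].

Definition UT : set 'M[R]_n := [set A | ut A /\ forall i, 0 < A i i].

Definition expmx A : 'M[R]_n := limn (series (fun k => k`!%:R^-1 *: A ^+ k)).

(* The inverse of the bijection [expmx] from [ut] to [UT]; the default value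
   0 is irrelevant on [UT]. *)
Definition logmx A : 'M[R]_n := xget 0 [set X | ut X /\ expmx X = A].

Definition powmx A (s : R) : 'M[R]_n := expmx (s *: logmx A).

Definition is_weight m (w : m.-tuple R) :=
  (forall i, 0 < tnth w i) /\ \sum_(i < m) tnth w i = 1.

Definition is_karcher_mean m (w : m.-tuple R) (A : m.-tuple 'M[R]_n) X :=
  [/\ is_weight w,
      (forall i, UT (tnth A i)),
      UT X &
      \sum_(i < m) tnth w i *: logmx (invmx X *m tnth A i) = 0].

(* Meaningful when there is exactly one Karcher mean. *)
Definition karcher_mean m (w : m.-tuple R) (A : m.-tuple 'M[R]_n) : 'M[R]_n :=
  xget 0 (is_karcher_mean w A).

(* A1 #_t A2 *)
Definition geomean (t : R) (A1 A2 : 'M[R]_n) : 'M[R]_n :=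
  karcher_mean [tuple 1 - t; t] [tuple A1; A2].

(* The n (n + 1) / 2 positions of the free entries of a matrix in [ut]. *)
Definition utpos := {p : 'I_n * 'I_n | (p.1 <= p.2)%N}.

Definition mx_of_entries (x : utpos -> R) : 'M[R]_n :=
  \matrix_(i, j) if insub (i, j) is Some p then x p else 0.

End UpperTriangular.

Section Analytic.
Variables (R : realType) (I : finType).

(* [f] is the sum, on a polydisc around [a], of a power series in the variables
   indexed by [I]. The sum over the multi-indices is unconditional: it is the
   limit of the sums over finite sets of multi-indices. *)
Definition analytic_at (f : (I -> R) -> R) (a : I -> R) :=
  exists (c : {ffun I -> nat} -> R) (r : R), 0 < r /\
    forall x : I -> R, (forall i, `|x i - a i| < r) ->
      partial_sum (fun k : {ffun I -> nat} =>
        c k * \prod_i (x i - a i) ^+ k i) @ totally --> f x.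

(* For open [U]. *)
Definition analytic_on (U : set (I -> R)) (f : (I -> R) -> R) :=
  forall a, U a -> analytic_at f a.

End Analytic.

(* Main.v *)
(** If [X] is the mean, [U = X^-1 A1] and [V = X^-1 A2], the Karcher equation
    reads [log U = - (t / (1 - t)) log V]; hence [A1^-1 A2 = U^-1 V] is the
    power [V^(1 / (1 - t))] and [X = A1 U^-1 = A1 (A1^-1 A2)^t].

    Logarithms exist and are unique because
      [exp [[mu, v], [0, X]] = [[e^mu, v D], [0, exp X]]],
    where [D] is triangular and has the divided differences of the exponential
    at [mu] and the eigenvalues of [X] on its diagonal, which do not vanish.
    Induction on the size gives the bijectivity of [exp], and also
      [log [[a, u], [0, A]] = [[ln a, u D^-1], [0, log A]]],
    which reduces the analyticity of [log] to that of [ln], of inverses and of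
    [exp].

    Analytic functions are handled as power series whose coefficients have a
    finite weighted l^1 norm on a polydisc: this is a Banach algebra, in which
    an absolutely convergent series of functions can be rearranged. *)

Require Import Defs.
From mathcomp Require Import all_boot all_order all_algebra finmap ring lra.
From mathcomp Require Import all_classical all_reals all_analysis.
From mathcomp.analysis.showcase Require Import summability.

Set Implicit Arguments.
Unset Strict Implicit.
Unset Printing Implicit Defensive.

Import Order.TTheory GRing.Theory Num.Theory numFieldNormedType.Exports.
Local Open Scope classical_set_scope.
Local Open Scope ring_scope.

(** * Unconditional sums *)

(* [summability] declares this instance inside a section. *)
#[local] Existing Instance totally_filter.

(** A power series around the identity does not reach all of [UT]; solving for the first row through
    [D] takes the place of an inverse function theorem. [D] is never computed from divided
    differences: it is the upper right block of the exponential of a matrix of twice the size. So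
    its analyticity is that of [exp], and its structure follows from one principle, [C X = Y C]
    implies [C exp X = exp Y C], applied to suitable rectangular [C]. The norm bounds are carried
    explicitly because an infinite sum of functions needs summable bounds, and because substitution
    into a one-variable series needs [f - f a] to have small norm; shrinking the polydisc achieves
    this, as the constant term vanishes. Signed families are reduced to nonnegative ones, whose sums
    are suprema in the extended reals and can always be interchanged. With [P = A1^-1 A2], the other
    two closed forms come from conjugating [P] by [A1^(1/2)], which gives [A1^(-1/2) A2 A1^(-1/2)],
    and by [A1], which gives [A2 A1^-1]; powers commute with conjugation. *)

Section Sums.
Variables (R : realType) (T : choiceType).
Implicit Types (x y u v : T -> R) (F : {fset T}).

Definition nsum x : \bar R := (\esum_(i in [set: T]) (`|x i|)%:E).

(* The unconditional sum of [x], as a difference of sums of nonnegative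
   families; a junk value if [x] is not absolutely summable. *)
Definition rsum x : R :=
  fine (\esum_(i in [set: T]) (`|x i| + x i)%:E) - fine (nsum x).

Lemma partial_sumE x F : partial_sum x F = \sum_(i <- F) x i.
Proof. by rewrite /partial_sum big_seq_fsetE. Qed.

Lemma nsum_ge0 x : (0 <= nsum x)%E.
Proof. by apply: esum_ge0 => i _; rewrite lee_fin. Qed.

Lemma fset_sum_le_esum u F : (forall i, 0 <= u i) ->
  ((\sum_(i <- F) u i)%:E <= \esum_(i in [set: T]) (u i)%:E)%E.
Proof.
move=> u0; apply: ereal_sup_ubound; exists [set` F]; first by split.
by rewrite fsbig_finite//= set_fsetK -sumEFin.
Qed.

Lemma esum_le_fset u (M : \bar R) :
  (forall F, ((\sum_(i <- F) u i)%:E <= M)%E) ->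
  (\esum_(i in [set: T]) (u i)%:E <= M)%E.
Proof.
move=> h; apply: ge_ereal_sup => _ [X [finX _] <-].
by rewrite fsbig_finite//= sumEFin; exact: h.
Qed.

(** The supremum is approached within [e] by the sum over some finite [X], and sums over larger
    finite sets lie between that one and the supremum. *)
Lemma cvg_partial_sum_ge0 u : (forall i, 0 <= u i) ->
  (\esum_(i in [set: T]) (u i)%:E < +oo)%E ->
  partial_sum u @ totally --> fine (\esum_(i in [set: T]) (u i)%:E).
Proof.
move=> u0 fu; set U := esum _ _.
have U0 : (0 <= U)%E by apply: esum_ge0 => i _; rewrite lee_fin.
have fU : U \is a fin_num by rewrite ge0_fin_numE.
have [r Ur] : exists r, U = r%:E by exists (fine U); rewrite fineK.
rewrite Ur /=; apply/cvgrPdist_le => e e0.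
have [_ [X [finX _] <-]] := ub_ereal_sup_adherent e0 fU.
rewrite fsbig_finite//= sumEFin -/(esum _ _) -/U Ur => h.
exists (fset_set X) => //= F XF; rewrite partial_sumE.
have := fset_sum_le_esum F u0; rewrite -/U Ur lee_fin => hF.
rewrite ger0_norm ?subr_ge0// lerBlDr -lerBlDl.
move: h; rewrite -EFinB lte_fin => /ltW/le_trans; apply.
rewrite [leRHS](big_fsetID _ (mem (fset_set X)))/=.
rewrite [X in _ <= X + _](_ : _ = \sum_(i <- fset_set X) u i).
  by rewrite lerDl; apply: sumr_ge0.
apply: perm_big; apply: uniq_perm; rewrite ?fset_uniq// => i.
rewrite !inE/=; case: (boolP (i \in fset_set X)); rewrite ?andbT ?andbF //.
by move=> iX; rewrite (fsubsetP XF).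
Qed.

(** Both [|x| + x] and [|x|] are nonnegative with finite sums, the first because it is at most
    [2 |x|]; their partial sums differ by that of [x]. *)
Lemma cvg_rsum x : (nsum x < +oo)%E -> partial_sum x @ totally --> rsum x.
Proof.
move=> fx.
have u0 i : 0 <= `|x i| + x i by have := ler_norm (- x i); rewrite normrN; lra.
have -> : partial_sum x =
   partial_sum (fun i => `|x i| + x i) - partial_sum (fun i => `|x i|).
  apply/funext => F; rewrite /= !fctE !partial_sumE -sumrB.
  by apply: eq_bigr => i _; rewrite addrAC subrr add0r.
apply: cvgB; apply: cvg_partial_sum_ge0 => //.
under eq_esum do rewrite EFinD.
apply: (@le_lt_trans _ _ (nsum x + nsum x)%E); last exact: lte_add_pinfty.
rewrite -esumD//; last first.
apply: le_esum => i _; rewrite -!EFinD lee_fin lerD2l; exact: ler_norm.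
Qed.

(** The working tool for evaluating [rsum]: the algebraic rules come from limits of partial sums
    instead of the definition through [fine]. *)
Lemma rsum_unique x s : (nsum x < +oo)%E ->
  partial_sum x @ totally --> s -> rsum x = s.
Proof. by move=> fx xs; apply: (norm_cvg_unique (cvg_rsum fx) xs). Qed.

Lemma eq_nsum x y : x =1 y -> nsum x = nsum y.
Proof. by move=> /funext ->. Qed.

Lemma eq_rsum x y : x =1 y -> rsum x = rsum y.
Proof. by move=> /funext ->. Qed.

Lemma le_nsum x y : (forall i, `|x i| <= `|y i|) -> (nsum x <= nsum y)%E.
Proof. by move=> xy; apply: le_esum => i _; rewrite lee_fin. Qed.

Lemma nsumD x y : (nsum (fun i => x i + y i)%R <= nsum x + nsum y)%E.
Proof.
rewrite -esumD; [|by move=> *; rewrite lee_fin..].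
by apply: le_esum => i _; rewrite -EFinD lee_fin ler_normD.
Qed.

Lemma nsumZ c x : (nsum (fun i => c * x i)%R <= `|c|%:E * nsum x)%E.
Proof.
apply: esum_le_fset => F.
under eq_bigr do rewrite normrM.
rewrite -mulr_sumr EFinM; apply: lee_wpmul2l; first by rewrite lee_fin.
exact: (fset_sum_le_esum F (fun i => normr_ge0 (x i))).
Qed.

Lemma nsumZ_lty c x : (nsum x < +oo)%E -> (nsum (fun i => c * x i)%R < +oo)%E.
Proof.
move=> fx; apply: (le_lt_trans (nsumZ c x)).
have : nsum x \is a fin_num by rewrite ge0_fin_numE ?nsum_ge0.
by move=> /fineK <-; rewrite -EFinM ltry.
Qed.

Lemma nsumD_lty x y : (nsum x < +oo)%E -> (nsum y < +oo)%E ->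
  (nsum (fun i => x i + y i)%R < +oo)%E.
Proof. by move=> fx fy; apply: (le_lt_trans (nsumD x y)); exact: lte_add_pinfty. Qed.

Lemma rsumZ c x : (nsum x < +oo)%E -> rsum (fun i => c * x i) = c * rsum x.
Proof.
move=> fx; apply: rsum_unique; first exact: nsumZ_lty.
have -> : partial_sum (fun i => c * x i) = (fun F => c * partial_sum x F).
  by apply/funext => F; rewrite !partial_sumE mulr_sumr.
by apply: cvgMr; exact: cvg_rsum.
Qed.

Lemma rsumD x y : (nsum x < +oo)%E -> (nsum y < +oo)%E ->
  rsum (fun i => x i + y i) = rsum x + rsum y.
Proof.
move=> fx fy; apply: rsum_unique; first exact: nsumD_lty.
have -> : partial_sum (fun i => x i + y i) = partial_sum x + partial_sum y.
  by apply/funext => F; rewrite fctE !partial_sumE big_split.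
by apply: cvgD; exact: cvg_rsum.
Qed.

Lemma norm_rsum_le x (M : R) : (nsum x <= M%:E)%E -> `|rsum x| <= M.
Proof.
move=> xM; have fx : (nsum x < +oo)%E by rewrite (le_lt_trans xM) ?ltry.
apply: (cvgr_to_le (cvg_norm (cvg_rsum fx))); apply: nearW => F.
rewrite partial_sumE (le_trans (ler_norm_sum _ _ _))// -lee_fin.
by apply: le_trans xM; apply: (fset_sum_le_esum F (fun i => normr_ge0 (x i))).
Qed.

Lemma rsum_fset x F : (forall i, i \notin F -> x i = 0) ->
  (nsum x < +oo)%E /\ rsum x = \sum_(i <- F) x i.
Proof.
move=> x0.
have e (y : T -> R) G : (forall i, i \notin F -> y i = 0) -> (F `<=` G)%fset ->
    \sum_(i <- G) y i = \sum_(i <- F) y i.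
  move=> y0 FG; rewrite (big_fsetID _ (mem F))/= [X in _ + X]big1_fset ?addr0.
    apply: perm_big; apply: uniq_perm; rewrite ?fset_uniq// => i.
    rewrite !inE/=; case: (boolP (i \in F)); rewrite ?andbT ?andbF //.
    by move=> iX; rewrite (fsubsetP FG).
  by move=> i; rewrite !inE => /andP[_ /y0].
have nx : (nsum x < +oo)%E.
  apply: le_lt_trans (ltry (\sum_(i <- F) `|x i|)); apply: esum_le_fset => G.
  rewrite lee_fin -(e (fun i => `|x i|) (F `|` G)%fset) ?fsubsetUl//; last first.
    by move=> i /x0 ->; rewrite normr0.
  rewrite (big_fsetID _ (mem G) (F `|` G)%fset)/=.
  rewrite [X in _ <= X + _](_ : _ = \sum_(i <- G) `|x i|).
    by rewrite lerDl; apply: sumr_ge0.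
  apply: perm_big; apply: uniq_perm; rewrite ?fset_uniq// => i.
  by rewrite !inE/=; case: (i \in G); rewrite ?andbT ?andbF ?orbT.
split=> //; apply: rsum_unique => //; apply/cvgrPdist_le => eps e0.
by exists F => //= G FG; rewrite partial_sumE e// subrr normr0 ltW.
Qed.

Lemma rsum_single x k : (forall i, i != k -> x i = 0) ->
  (nsum x < +oo)%E /\ rsum x = x k.
Proof.
move=> x0; have [i|nx ->] := @rsum_fset x [fset k]%fset; first by rewrite inE => /x0.
by rewrite big_seq_fset1.
Qed.

Lemma nsum_single x k : (forall i, i != k -> x i = 0) ->
  nsum x = `|x k|%:E.
Proof.
move=> x0; rewrite /nsum (esumID [set k]) /=; last by move=> *; rewrite lee_fin.
rewrite setTI esum_set1 ?lee_fin// esum1 ?adde0// => i [_ /= /eqP ik].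
by rewrite x0 ?normr0.
Qed.

End Sums.

(** * Interchange of sums *)

Section EsumSwap.
Variables (R : realType) (J K : choiceType).

(** Tonelli: both iterated sums are sums over pairs, matched by exchanging the components. *)
Lemma esum_swap (a : J -> K -> \bar R) : (forall j k, (0 <= a j k)%E) ->
  (\esum_(j in [set: J]) \esum_(k in [set: K]) a j k =
   \esum_(k in [set: K]) \esum_(j in [set: J]) a j k)%E.
Proof.
move=> a0; rewrite !esum_esum//.
rewrite (@reindex_esum _ _ _ ([set: K] `*`` (fun=> [set: J])) _
  (fun p => (p.2, p.1)))//; split=> //.
- by move=> [k j] [k' j'] _ _ /= [-> ->].
- by move=> [j k] _; exists (k, j).
Qed.
End EsumSwap.

Section RsumSwap.
Variable R : realType.

Lemma rsum_ge0E (T : choiceType) (u : T -> R) : (forall i, 0 <= u i) ->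
  (\esum_(i in [set: T]) (u i)%:E < +oo)%E ->
  rsum u = fine (\esum_(i in [set: T]) (u i)%:E).
Proof.
move=> u0 fu; apply: rsum_unique; last exact: cvg_partial_sum_ge0.
by rewrite /nsum; under eq_esum do rewrite ger0_norm//.
Qed.

Lemma esum_lty (T : choiceType) (a : T -> \bar R) : (forall i, (0 <= a i)%E) ->
  (\esum_(i in [set: T]) a i < +oo)%E -> forall i, a i = (fine (a i))%:E.
Proof.
move=> a0 fa i; rewrite fineK// ge0_fin_numE//.
have := @summable_pinfty T R setT a; rewrite /esum.summable.
under eq_esum do rewrite gee0_abs//.
by move=> /(_ fa i Logic.I); rewrite gee0_abs.
Qed.

Lemma nsum_rsum_le (J K : choiceType) (x : J -> K -> R) :
  (forall j, nsum (x j) < +oo)%E ->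
  (nsum (fun j => rsum (x j)) <= \esum_(j in [set: J]) nsum (x j))%E.
Proof.
move=> fx; apply: le_esum => j _.
have e : nsum (x j) = (fine (nsum (x j)))%:E by rewrite fineK// ge0_fin_numE// nsum_ge0.
by rewrite e lee_fin norm_rsum_le// {1}e.
Qed.

Lemma rsum_rsum_ge0 (J K : choiceType) (u : J -> K -> R) :
  (forall j k, 0 <= u j k) ->
  (\esum_(j in [set: J]) \esum_(k in [set: K]) (u j k)%:E < +oo)%E ->
  [/\ (nsum (fun j => fine (\esum_(k in [set: K]) (u j k)%:E)) < +oo)%E &
  rsum (fun j => fine (\esum_(k in [set: K]) (u j k)%:E)) =
  fine (\esum_(j in [set: J]) \esum_(k in [set: K]) (u j k)%:E)].
Proof.
move=> u0 fu.
have k0 j : (0 <= \esum_(k in [set: K]) (u j k)%:E)%E.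
  by apply: esum_ge0 => k _; rewrite lee_fin.
have e := esum_lty k0 fu.
have fe : (\esum_(j in [set: J]) (fine (\esum_(k in [set: K]) (u j k)%:E))%:E =
   \esum_(j in [set: J]) \esum_(k in [set: K]) (u j k)%:E)%E.
  by apply: eq_esum => j _; rewrite -e.
have f0 j : 0 <= fine (\esum_(k in [set: K]) (u j k)%:E) by exact: fine_ge0.
split; first by rewrite /nsum; under eq_esum do rewrite ger0_norm//; rewrite fe.
by rewrite rsum_ge0E ?fe.
Qed.

(** Splits a signed double sum into two nonnegative ones in the extended reals, so that Fubini
    reduces to [esum_swap]. *)
Lemma rsum_rsum (J K : choiceType) (x : J -> K -> R) :
  (\esum_(j in [set: J]) nsum (x j) < +oo)%E ->
  rsum (fun j => rsum (x j)) =
  fine (\esum_(j in [set: J]) \esum_(k in [set: K]) (`|x j k| + x j k)%:E)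
  - fine (\esum_(j in [set: J]) \esum_(k in [set: K]) (`|x j k|)%:E).
Proof.
move=> fx.
have u0 j k : 0 <= `|x j k| + x j k.
  by have := ler_norm (- x j k); rewrite normrN; lra.
have fu : (\esum_(j in [set: J]) \esum_(k in [set: K]) (`|x j k| + x j k)%:E
    < +oo)%E.
  apply: (@le_lt_trans _ _ (\esum_(j in [set: J]) (nsum (x j) + nsum (x j)))%E).
    apply: le_esum => j _; rewrite -esumD; [|by move=> *; rewrite lee_fin..].
    by apply: le_esum => k _; rewrite -EFinD lee_fin lerD2l ler_norm.
  by rewrite esumD; [exact: lte_add_pinfty|move=> *; exact: nsum_ge0..].
have [nu <-] := rsum_rsum_ge0 u0 fu.
have [nv <-] := rsum_rsum_ge0 (fun j k => normr_ge0 (x j k)) fx.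
rewrite -[X in _ - X]mul1r -mulNr -rsumZ// -rsumD//; last exact: nsumZ_lty.
by apply: eq_rsum => j; rewrite mulN1r.
Qed.

Lemma rsum_swap (J K : choiceType) (x : J -> K -> R) :
  (\esum_(j in [set: J]) nsum (x j) < +oo)%E ->
  rsum (fun j => rsum (x j)) = rsum (fun k => rsum (x^~ k)).
Proof.
move=> fx.
have u0 j k : 0 <= `|x j k| + x j k.
  by have := ler_norm (- x j k); rewrite normrN; lra.
rewrite !rsum_rsum//; last by rewrite -esum_swap// => *; rewrite lee_fin.
by congr (fine _ - fine _); rewrite esum_swap// => *; rewrite lee_fin.
Qed.

End RsumSwap.

(** * Sums over the natural numbers *)

Section NatSum.
Variable R : realType.
Implicit Types x : nat -> R.

Lemma nsum_natP x (M : R) : (forall n, series (fun k => `|x k|) n <= M) ->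
  (nsum x <= M%:E)%E.
Proof.
move=> xM; rewrite /nsum -nneseries_esumT; last by move=> *; rewrite lee_fin.
apply: lime_le; first by apply: is_cvg_nneseries => *; rewrite lee_fin.
by apply: nearW => n; rewrite sumEFin lee_fin; exact: xM.
Qed.

(** Initial segments eventually contain any given finite set. This is the bridge to [series], whose
    known limits then identify values of [rsum]. *)
Lemma cvg_series_rsum x : (nsum x < +oo)%E -> series x @ \oo --> rsum x.
Proof.
move=> fx; have h := cvg_rsum fx.
have -> : series x = partial_sum x \o (fun n => [fset k | k in iota 0 n]%fset).
  apply/funext => n /=; rewrite partial_sumE /series/= /index_iota subn0.
  by rewrite big_imfset//= undup_id ?iota_uniq.
apply: (cvg_comp _ _ _ h) => A [F _ FA].
exists (\max_(k <- F) k).+1 => // n /= Fn; apply: FA => /=.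
apply/fsubsetP => k kF; apply/imfsetP; exists k => //=.
rewrite mem_iota add0n (leq_trans _ Fn)// ltnS.
by rewrite (big_rem k)//= leq_maxl.
Qed.

Lemma rsum_nat x s : (nsum x < +oo)%E -> series x @ \oo --> s -> rsum x = s.
Proof. by move=> fx xs; apply: (norm_cvg_unique (cvg_series_rsum fx) xs). Qed.

Lemma rsum_ord x n : (forall k, (n <= k)%N -> x k = 0) ->
  (nsum x < +oo)%E /\ rsum x = \sum_(k < n) x k.
Proof.
move=> x0; have [i|nx ->] := @rsum_fset _ _ x [fset k | k in iota 0 n]%fset.
  move=> h; apply: x0; rewrite leqNgt; apply: contra h => h.
  by apply/imfsetP; exists i => //=; rewrite mem_iota.
by split=> //; rewrite big_imfset//= undup_id ?iota_uniq// -{1}[n]subn0 big_mkord.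
Qed.

(** Prepending zeros is how the rows of a Cauchy product get lined up along its antidiagonals. *)
Lemma nsum_shift x (n : nat) :
  nsum (fun k => if (n <= k)%N then x (k - n)%N else 0) = nsum x.
Proof.
rewrite /nsum (esumID [set k | (n <= k)%N]); last by move=> *; rewrite lee_fin.
rewrite !setTI [X in (_ + X)%E]esum1 ?adde0; last first.
  by move=> k /= /negP/negbTE ->; rewrite normr0.
rewrite (@reindex_esum _ _ _ [set: nat] _ (fun k => k + n)%N); last split => //.
- by apply: eq_esum => k _; rewrite leq_addl addnK.
- by move=> k _ /=; rewrite leq_addl.
- by move=> k k' _ _ /addIn.
- by move=> k /= nk; exists (k - n)%N => //; rewrite subnK.
Qed.

Lemma rsum_shift x (n : nat) : (nsum x < +oo)%E ->
  rsum (fun k => if (n <= k)%N then x (k - n)%N else 0) = rsum x.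
Proof.
move=> fx; apply: rsum_nat; first by rewrite nsum_shift.
rewrite -(cvg_shiftn n); set f := (X in X @ _ --> _).
suff -> : f = series x by exact: cvg_series_rsum.
apply/funext => m; rewrite /f /series/= (@big_cat_nat _ _ _ n)//= ?leq_addl//.
rewrite big_nat_cond big1 ?add0r; last by move=> i /andP[/andP[_ h] _]; rewrite leqNgt h.
rewrite -{1}[n]add0n big_addn addnK; apply: eq_bigr => i _.
by rewrite leq_addl addnK.
Qed.
End NatSum.

Lemma nsum_term_lty (R : realType) (J K : choiceType) (x : J -> K -> R) :
  (\esum_(j in [set: J]) nsum (x j) < +oo)%E -> forall j, (nsum (x j) < +oo)%E.
Proof. by move=> fx j; rewrite (esum_lty (fun j => nsum_ge0 (x j)) fx j) ltry. Qed.

Lemma esum_nsum_swap (R : realType) (J K : choiceType) (x : J -> K -> R) :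
  (\esum_(j in [set: J]) nsum (x j) = \esum_(k in [set: K]) nsum (x^~ k))%E.
Proof. by rewrite /nsum esum_swap// => *; rewrite lee_fin. Qed.

(** * Power series in several variables *)

Section PowerSeries.
Variables (R : realType) (I : finType) (a : I -> R).
Local Notation K := {ffun I -> nat}.
Implicit Types (f g : (I -> R) -> R) (h x : I -> R) (k e : K) (c : K -> R).

Definition monomial k h := \prod_i h i ^+ k i.

Definition addk k e : K := [ffun i => (k i + e i)%N].

Lemma monoD k e h : monomial (addk k e) h = monomial k h * monomial e h.
Proof. by rewrite /monomial -big_split; apply: eq_bigr => i _; rewrite ffunE exprD. Qed.

Lemma mono_ge0 k (r : R) : 0 <= r -> 0 <= monomial k (fun=> r).
Proof. by move=> r0; apply: prodr_ge0 => i _; exact: exprn_ge0. Qed.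

Lemma mono_gt0 k (r : R) : 0 < r -> 0 < monomial k (fun=> r).
Proof. by move=> r0; apply: prodr_gt0 => i _; exact: exprn_gt0. Qed.

Lemma norm_mono_le k h (r : R) : (forall i, `|h i| <= r) ->
  `|monomial k h| <= monomial k (fun=> r).
Proof.
move=> hr; rewrite /monomial normr_prod; apply: ler_prod => i _.
by rewrite normr_ge0 normrX lerXn2r// ?nnegrE// (le_trans _ (hr i)).
Qed.

Definition near_pt (r : R) x := forall i, `|x i - a i| <= r.

(* [f] is a power series around [a] on the closed polydisc of radius [r], and
   [M] bounds the l^1 norm of its coefficients with weights [r ^ |k|]. *)
Definition pseries_bound (r M : R) f :=
  exists2 c, (nsum (fun k => (c k * monomial k (fun=> r))%R) <= M%:E)%E &
    forall x, near_pt r x -> f x = rsum (fun k => c k * monomial k (fun i => x i - a i)).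

Lemma nsum_mono_le c (r : R) x : near_pt r x ->
  (nsum (fun k => (c k * monomial k (fun i => x i - a i))%R) <=
   nsum (fun k => (c k * monomial k (fun=> r))%R))%E.
Proof.
move=> xr; apply: le_nsum => k; rewrite !normrM ler_wpM2l//.
by rewrite (le_trans (norm_mono_le k xr))// ler_norm.
Qed.

Lemma pseries_norm_le (r M : R) f x : pseries_bound r M f -> near_pt r x -> `|f x| <= M.
Proof.
move=> [c cM fE] xr; rewrite fE//; apply: norm_rsum_le.
exact: le_trans (nsum_mono_le _ xr) cM.
Qed.

Lemma pseries_ge0 (r M : R) f : pseries_bound r M f -> 0 <= M.
Proof. by move=> [c cM _]; rewrite -lee_fin (le_trans _ cM)// nsum_ge0. Qed.

Lemma pseries_ext (r M : R) f g : (forall x, near_pt r x -> f x = g x) ->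
  pseries_bound r M f -> pseries_bound r M g.
Proof. by move=> fg [c cM fE]; exists c => // x xr; rewrite -fg// fE. Qed.

Lemma pseries_le (r M M' : R) f : M <= M' -> pseries_bound r M f -> pseries_bound r M' f.
Proof. by move=> MM' [c cM fE]; exists c => //; rewrite (le_trans cM). Qed.

Lemma pseries_radius (r r' M : R) f : 0 < r' <= r -> pseries_bound r M f -> pseries_bound r' M f.
Proof.
move=> /andP[r0 rr'] [c cM fE]; exists c => [|x xr]; last first.
  by apply: fE => i; exact: le_trans (xr i) rr'.
apply: le_trans cM; apply: le_nsum => k; rewrite !normrM ler_wpM2l//.
have r'0 := ltW r0; have r1 := le_trans r'0 rr'.
rewrite !ger0_norm ?mono_ge0//.
rewrite /monomial; apply: ler_prod => i _; rewrite exprn_ge0//=.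
by rewrite lerXn2r.
Qed.

Lemma pseries_mono (r b : R) e : 0 < r ->
  pseries_bound r (`|b| * monomial e (fun=> r)) (fun x => b * monomial e (fun i => x i - a i)).
Proof.
move=> r0; exists (fun k => if k == e then b else 0) => [|x _].
  rewrite (@nsum_single _ _ _ e); last by move=> k /negbTE ->; rewrite mul0r.
  by rewrite eqxx normrM (ger0_norm (mono_ge0 _ (ltW r0))).
have [k|_ ->] := @rsum_single R K (fun k => (if k == e then b else 0) *
    monomial k (fun i => x i - a i)) e; last by rewrite eqxx.
by move=> /negbTE ->; rewrite mul0r.
Qed.

(** Completeness of the weighted l^1 space: the coefficient of index [k] of the sum is the sum over
    [j] of the coefficients [c j k], and the bound [B] on the double family permits the interchange.
    Products, compositions and [expmx] all rest on this. *)
Lemma pseries_sum (J : choiceType) (F : J -> (I -> R) -> R) (M : J -> R) (r B : R) f :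
  0 < r -> (forall j, pseries_bound r (M j) (F j)) ->
  (\esum_(j in [set: J]) (M j)%:E <= B%:E)%E ->
  (forall x, near_pt r x -> f x = rsum (F^~ x)) -> pseries_bound r B f.
Proof.
move=> r0 FM MB fE.
have /choice[c cM] : forall j, exists c : K -> R,
    (nsum (fun k => (c k * monomial k (fun=> r))%R) <= (M j)%:E)%E /\
    forall x, near_pt r x ->
      F j x = rsum (fun k => c k * monomial k (fun i => x i - a i)).
  by move=> j; have [c ? ?] := FM j; exists c.
have sB : (\esum_(j in [set: J]) nsum (fun k => (c j k * monomial k (fun=> r))%R)
    <= B%:E)%E.
  by apply: le_trans MB; apply: le_esum => j _; have [] := cM j.
have sB' := sB; rewrite esum_nsum_swap in sB'.
(* Column [k] is summable with its weight, hence also without it, the weight being a positive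
   constant in [j]. *)
have ck k : (nsum (c^~ k) < +oo)%E.
  have := nsum_term_lty (le_lt_trans sB' (ltry _)) k.
  move=> /(nsumZ_lty (monomial k (fun=> r))^-1); congr (_ < _)%E.
  by apply: eq_nsum => j; rewrite mulrC mulfK// gt_eqF// mono_gt0.
exists (fun k => rsum (c^~ k)) => [|x xr].
  apply: le_trans sB'; rewrite (@eq_nsum _ _ _
    (fun k => rsum (fun j => c j k * monomial k (fun=> r)))); last first.
    move=> k; rewrite mulrC -rsumZ//.
    by apply: eq_rsum => j; rewrite mulrC.
  apply: nsum_rsum_le => k; under eq_nsum do rewrite mulrC.
  exact: nsumZ_lty.
rewrite fE// (_ : (F^~ x) = fun j =>
    rsum (fun k => c j k * monomial k (fun i => x i - a i))); last first.
  by apply/funext => j; have [_ ->] := cM j.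
rewrite rsum_swap.
  apply: eq_rsum => k; rewrite [RHS]mulrC -rsumZ//.
  by apply: eq_rsum => j; rewrite mulrC.
apply: (le_lt_trans _ (ltry B)); apply: le_trans sB.
by apply: le_esum => j _; exact: nsum_mono_le.
Qed.

Lemma pseries_cst (r b : R) : 0 < r -> pseries_bound r `|b| (fun=> b).
Proof.
move=> r0; have e0 h : monomial [ffun=> 0%N] h = 1.
  by apply: big1 => i _; rewrite ffunE expr0.
have := @pseries_mono r b [ffun=> 0%N] r0; rewrite e0 mulr1.
by apply: pseries_ext => x _; rewrite e0 mulr1.
Qed.

Lemma pseries_coord (r : R) i : 0 < r -> pseries_bound r r (fun x => x i - a i).
Proof.
move=> r0; have e0 h : monomial [ffun j => nat_of_bool (j == i)] h = h i.
  rewrite /monomial (bigD1 i)//= ffunE eqxx expr1 big1 ?mulr1// => j /negbTE ji.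
  by rewrite ffunE ji expr0.
have := @pseries_mono r 1 [ffun j => nat_of_bool (j == i)] r0; rewrite e0 normr1 mul1r.
by apply: pseries_ext => x _; rewrite e0 mul1r.
Qed.

Lemma pseries_add (r M N : R) f g : pseries_bound r M f -> pseries_bound r N g ->
  pseries_bound r (M + N) (fun x => f x + g x).
Proof.
move=> [c cM fE] [d dN gE].
have fin c' N' : (nsum (fun k => (c' k * monomial k (fun=> r))%R) <= N'%:E)%E ->
    forall x, near_pt r x ->
    (nsum (fun k => (c' k * monomial k (fun i => x i - a i))%R) < +oo)%E.
  move=> h x xr; apply: le_lt_trans (ltry N'); apply: le_trans h.
  exact: nsum_mono_le.
exists (fun k => c k + d k) => [|x xr].
  under eq_nsum do rewrite mulrDl.
  by apply: (le_trans (nsumD _ _)); rewrite EFinD leeD.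
rewrite fE// gE// -rsumD; [|exact: fin cM _ xr|exact: fin dN _ xr].
by apply: eq_rsum => k; rewrite mulrDl.
Qed.

(** Shifting exponents by [e] is not onto in general, so the product is presented as an infinite sum
    of single monomials rather than by its coefficients. *)
Lemma pseries_monoM (r M : R) e g : 0 < r -> pseries_bound r M g ->
  pseries_bound r (monomial e (fun=> r) * M) (fun x => monomial e (fun i => x i - a i) * g x).
Proof.
move=> r0 [c cM gE].
apply: (@pseries_sum _ (fun k x => c k * monomial (addk e k) (fun i => x i - a i))
  (fun k => `|c k| * monomial (addk e k) (fun=> r))) => //.
- by move=> k; exact: pseries_mono.
- rewrite (@eq_esum _ _ _ _ (fun k =>
     (`|monomial e (fun=> r) * (c k * monomial k (fun=> r))|)%:E)); last first.
    by move=> k _; rewrite monoD mulrCA !normrM !(ger0_norm (mono_ge0 _ (ltW r0))).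
  apply: (le_trans (nsumZ _ _)).
  have e0 := mono_ge0 e (ltW r0).
  by rewrite ger0_norm// EFinM lee_wpmul2l.
- move=> x xr; rewrite gE// -rsumZ.
    by apply: eq_rsum => k; rewrite monoD mulrCA.
  apply: le_lt_trans (ltry M); apply: le_trans cM; exact: nsum_mono_le.
Qed.

Lemma pseries_scale (r M b : R) f : pseries_bound r M f -> pseries_bound r (`|b| * M) (fun x => b * f x).
Proof.
move=> [c cM fE]; exists (fun k => b * c k) => [|x xr].
  under eq_nsum do rewrite -mulrA.
  by apply: (le_trans (nsumZ _ _)); rewrite EFinM lee_wpmul2l.
rewrite fE// -rsumZ; first by apply: eq_rsum => k; rewrite mulrA.
apply: le_lt_trans (ltry M); apply: le_trans cM; exact: nsum_mono_le.
Qed.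

(** Expanding [f] alone makes [f g] a sum of monomials times [g]; no convolution of coefficients has
    to be written. *)
Lemma pseries_mul (r M N : R) f g : 0 < r -> pseries_bound r M f -> pseries_bound r N g ->
  pseries_bound r (M * N) (fun x => f x * g x).
Proof.
move=> r0 [c cM fE] gN; have N0 := pseries_ge0 gN.
apply: (@pseries_sum _ (fun k x => c k * (monomial k (fun i => x i - a i) * g x))
  (fun k => `|c k| * (monomial k (fun=> r) * N))) => //.
- by move=> k; apply: pseries_scale; exact: pseries_monoM.
- rewrite (@eq_esum _ _ _ _ (fun k => (`|N * (c k * monomial k (fun=> r))|)%:E)).
    by apply: (le_trans (nsumZ _ _)); rewrite ger0_norm// mulrC EFinM lee_wpmul2l.
  move=> k _; rewrite !normrM (ger0_norm N0) (ger0_norm (mono_ge0 _ (ltW r0))).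
  by congr EFin; ring.
- move=> x xr; rewrite fE// mulrC -rsumZ.
    by apply: eq_rsum => k; rewrite mulrC mulrA.
  apply: le_lt_trans (ltry M); apply: le_trans cM; exact: nsum_mono_le.
Qed.

Lemma mono0 k : k != [ffun=> 0%N] -> monomial k (fun i => a i - a i) = 0.
Proof.
move=> k0; have [i ki] : exists i, k i != 0%N.
  apply/existsP; apply: contraR k0; rewrite negb_exists => /forallP k0.
  by apply/eqP/ffunP => i; rewrite ffunE; apply/eqP; rewrite -[_ == _]negbK.
by rewrite /monomial (bigD1 i)//= subrr expr0n (negbTE ki) mul0r.
Qed.

Lemma mono_ratio_le k (q : R) : 0 <= q <= 1 -> k != [ffun=> 0%N] ->
  monomial k (fun=> q) <= q.
Proof.
move=> /andP[q0 q1] k0; have [i ki] : exists i, k i != 0%N.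
  apply/existsP; apply: contraR k0; rewrite negb_exists => /forallP k0.
  by apply/eqP/ffunP => i; rewrite ffunE; apply/eqP; rewrite -[_ == _]negbK.
rewrite /monomial (bigD1 i)//= -[leRHS]mulr1 ler_pM ?exprn_ge0 ?prodr_ge0//.
- by move=> j _; rewrite exprn_ge0.
- by rewrite -[leRHS]expr1 ler_wiXn2l// lt0n.
- by apply: prodr_ile1 => j _; rewrite exprn_ge0//= exprn_ile1.
Qed.

(** Without constant term, every remaining monomial has positive degree, so passing to radius [r']
    multiplies its weight by at most [r' / r]. *)
Lemma pseries_shrink (r r' M : R) f : 0 < r' <= r -> f a = 0 -> pseries_bound r M f ->
  pseries_bound r' (r' / r * M) f.
Proof.
move=> /andP[r'0 rr'] fa [c cM fE]; have r0 := lt_le_trans r'0 rr'.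
have q0 : 0 <= r' / r by rewrite divr_ge0// ltW.
move qE : (r' / r) q0 => q q0.
(* At the centre all other monomials vanish, so this coefficient is [f a]. *)
have c0 : c [ffun=> 0%N] = 0.
  have := fE a; rewrite fa => /(_ _)/esym h.
  have [k /mono0 ->|_] := @rsum_single R K
     (fun k => c k * monomial k (fun i => a i - a i)) [ffun=> 0%N]; rewrite ?mulr0//.
  rewrite h; last by move=> i; rewrite subrr normr0 ltW.
  rewrite /monomial big1 ?mulr1// => i _; by rewrite ffunE expr0.
exists c => [|x xr]; last by apply: fE => i; exact: le_trans (xr i) rr'.
apply: (@le_trans _ _ (nsum (fun k => q * (c k * monomial k (fun=> r))))).
  apply: le_nsum => k; have [->|k0] := eqVneq k [ffun=> 0%N].
    by rewrite c0 !mul0r mulr0.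
  have m0 := mono_ge0 k (ltW r0); have m'0 := mono_ge0 k (ltW r'0).
  rewrite !normrM mulrCA ler_wpM2l// (ger0_norm m0) (ger0_norm m'0) (ger0_norm q0).
  rewrite (_ : monomial k (fun=> r') = monomial k (fun=> q) * monomial k (fun=> r)).
    by rewrite ler_wpM2r// mono_ratio_le// q0/= -qE ler_pdivrMr// mul1r.
  by rewrite -big_split; apply: eq_bigr => i _ /=; rewrite -exprMn -qE divfK// gt_eqF.
by apply: (le_trans (nsumZ _ _)); rewrite ger0_norm// EFinM lee_wpmul2l.
Qed.

End PowerSeries.

(** * Analytic functions *)

Section LnSeries.
Variable R : realType.

Lemma nsum_dom (x : nat -> R) (y : nat -> R) (s : R) :
  (forall k, `|x k| <= y k) -> series y @ \oo --> s -> (nsum x < +oo)%E.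
Proof.
move=> xy ys; apply: le_lt_trans (ltry s); apply: nsum_natP => n.
have y0 k : 0 <= y k by apply: le_trans (xy k).
apply: (@le_trans _ _ (series y n)); first exact: ler_sum.
rewrite -(cvg_lim _ ys)//; apply: nondecreasing_cvgn_le; last by apply/cvg_ex; exists s.
by apply/nondecreasing_seqP => m; rewrite /series/= big_nat_recr//= lerDl.
Qed.

Lemma rsum_geometric (z : R) : `|z| < 1 ->
  (nsum (fun k => z ^+ k)%R < +oo)%E /\ rsum (fun k => z ^+ k) = (1 - z)^-1.
Proof.
move=> z1.
have e (w : R) : (fun k => w ^+ k) = geometric 1 w.
  by apply/funext => k; rewrite /geometric/= mul1r.
have nz : (nsum (fun k => z ^+ k)%R < +oo)%E.
  apply: (@nsum_dom _ (fun k => `|z| ^+ k) (1 * (1 - `|z|)^-1)).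
    by move=> k; rewrite normrX.
  by rewrite e; apply: cvg_geometric_series; rewrite normr_id.
split=> //; apply: rsum_nat => //; rewrite -[_^-1]mul1r e.
exact: cvg_geometric_series.
Qed.

Lemma derive0_cst (f : R -> R) (rho x : R) :
  (forall y : R, `|y| < rho -> is_derive y 1 f 0) -> `|x| < rho -> f x = f 0.
Proof.
move=> df; rewrite ltr_norml => /andP[x1 x2].
have sub (u v : R) : - rho < u -> v < rho -> u <= v -> f v = f u.
  move=> u1 v2 uv; have d y : y \in `[u, v] -> is_derive y 1 f 0.
    by rewrite in_itv/= => /andP[? ?]; apply: df; rewrite ltr_norml; lra.
  have d' y : y \in `]u, v[ -> is_derive y 1 f 0.
    by move=> yi; apply: d; apply: subset_itv_oo_cc yi.
  have cf : {within `[u, v], continuous f}.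
    by apply: derivable_within_continuous => y yi; have [] := d y yi.
  have [c _] := MVT_segment uv d' cf.
  by rewrite mul0r => /subr0_eq.
have [x0|/ltW x0] := leP 0 x; first by apply: sub => //; lra.
by apply/esym/sub => //; lra.
Qed.

(* The coefficient of index 0 is 0, since [0^-1 = 0]. *)
Definition ln_coef k : R := (-1) ^+ k.+1 / k%:R.

Lemma norm_ln_coef k : `|ln_coef k| <= 1.
Proof.
rewrite normrM normrX normrN1 expr1n mul1r normfV normr_nat.
case: k => [|k]; first by rewrite invr0.
by rewrite invf_le1 ?ltr0n// ler1n.
Qed.

Lemma nsum_bounded_coef (c : nat -> R) (z : R) : (forall k, `|c k| <= 1) ->
  `|z| < 1 -> (nsum (fun k => (c k * z ^+ k)%R) < +oo)%E.
Proof.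
move=> c1 z1; have [+ _] := rsum_geometric z1; apply: le_lt_trans.
by apply: le_nsum => k; rewrite normrM ler_piMl.
Qed.

(** Serves the second derivative of the series of [ln], whose coefficients grow linearly. *)
Lemma nsum_linear_coef (c : nat -> R) (z : R) : (forall k, `|c k| <= k.+1%:R) ->
  0 <= z < 1 -> (nsum (fun k => (c k * z ^+ k)%R) < +oo)%E.
Proof.
move=> ck /andP[z0 z1]; apply: le_lt_trans (ltry ((1 - z) ^- 2)).
apply: nsum_natP => n; rewrite -[leRHS]mul1r ler_pdivlMr; last first.
  by rewrite exprn_gt0// subr_gt0.
apply: (@le_trans _ _ ((\sum_(0 <= k < n) k.+1%:R * z ^+ k) * (1 - z) ^+ 2)).
  rewrite ler_wpM2r ?sqr_ge0//; apply: ler_sum => k _.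
  by rewrite normrM normrX (ger0_norm z0) ler_wpM2r// exprn_ge0.
(* Closed form of [(1 - z)^2] times the partial sum of [(k + 1) z^k]; it is at most 1 because
   [n z^(n+1) <= (n + 1) z^n]. *)
rewrite (_ : _ * _ = 1 - n.+1%:R * z ^+ n + n%:R * z ^+ n.+1).
  rewrite -addrA gerDl addrC subr_le0 ler_pM ?exprn_ge0 ?ler_nat//.
  by rewrite exprS ler_piMl ?exprn_ge0// ltW.
elim: n => [|n IH]; first by rewrite big_nil !mul0r expr0 mul1r subrr addr0.
by rewrite big_nat_recr//= mulrDl IH !exprS -!natr1; ring.
Qed.

(** Both sides vanish at 0 and have derivative [1 / (1 + x)], the series by termwise
    differentiation. The constant [3 / 4] is a choice strictly between [1 / 2], the ratio met in
    [analytic_ln], and the radius of convergence 1. *)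
Lemma ln_series (x : R) : `|x| < 3 / 4 ->
  ln (1 + x) = rsum (fun k => ln_coef k * x ^+ k).
Proof.
move=> x34.
have d1 k : pseries_diffs ln_coef k = (-1) ^+ k.
  rewrite /pseries_diffs /ln_coef mulrCA divff ?mulr1; last by rewrite pnatr_eq0.
  by rewrite !exprS !mulN1r opprK.
have d2 k : `|pseries_diffs (pseries_diffs ln_coef) k| <= k.+1%:R.
  by rewrite {1}/pseries_diffs d1 normrM normrX normrN1 expr1n mulr1 normr_nat.
have d1' k : `|pseries_diffs ln_coef k| <= 1 by rewrite d1 normrX normrN1 expr1n.
have K1 : `|3 / 4 : R| < 1 by rewrite ger0_norm; lra.
have lim_rsum (c : nat -> R) z : (nsum (fun k => (c k * z ^+ k)%R) < +oo)%E ->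
    cvgn (pseries c z) /\ limn (pseries c z) = rsum (fun k => c k * z ^+ k).
  move=> /cvg_series_rsum h; split; first by apply/cvg_ex; eexists; exact: h.
  exact: cvg_lim h.
pose F y := limn (pseries ln_coef y) - ln (1 + y).
have x1 : `|x| < 1 by lra.
have [_ limx] := lim_rsum _ _ (nsum_bounded_coef norm_ln_coef x1).
have F0 : F 0 = 0.
  rewrite /F addr0 ln1 subr0; have [|_ ->] := lim_rsum ln_coef 0.
    by apply: nsum_bounded_coef norm_ln_coef _; rewrite normr0.
  have [|_ ->] := @rsum_single R _ (fun k => ln_coef k * 0 ^+ k) 0%N.
    by move=> k /negbTE k0; rewrite expr0n k0 mulr0.
  by rewrite /ln_coef invr0 mulr0 mul0r.
suff : F x = F 0 by rewrite F0 /F limx => /subr0_eq.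
apply: (@derive0_cst _ (3 / 4)) => // y y34.
have y1 : 0 < 1 + y by move: y34; rewrite ltr_norml; lra.
have y1' : `|y| < 1 by lra.
have dln := is_derive1_ln y1.
have dP : is_derive y (1 : R) (fun y : R => limn (pseries ln_coef y))
    (limn (pseries (pseries_diffs ln_coef) y)).
  apply: (@pseries_snd_diffs _ _ (3 / 4)).
  - by have [] := lim_rsum _ _ (nsum_bounded_coef norm_ln_coef K1).
  - by have [] := lim_rsum _ _ (nsum_bounded_coef d1' K1).
  - have [|//] := lim_rsum (pseries_diffs (pseries_diffs ln_coef)) (3 / 4).
    by apply: nsum_linear_coef => //; lra.
  - by rewrite [ltRHS]ger0_norm//; lra.
have [_ limy] := lim_rsum _ _ (nsum_bounded_coef d1' y1').
rewrite limy in dP.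
have yN : `|- y| < 1 by rewrite normrN.
have [_ geo] := rsum_geometric yN.
rewrite (_ : rsum _ = (1 + y)^-1) in dP; last first.
  rewrite -[y in RHS]opprK -geo; apply: eq_rsum => k.
  by rewrite d1 [in RHS]exprNn.
have dl : is_derive y (1 : R) (fun y : R => ln (1 + y)) ((1 + y)^-1).
  have d1y : is_derive y (1 : R) (fun y : R => 1 + y) 1.
    by rewrite -[X in is_derive _ _ _ X]add0r; apply: is_deriveD.
  by have := is_derive1_comp dln d1y; rewrite mulr1.
have := is_deriveB dP dl; rewrite subrr; exact.
Qed.
End LnSeries.

Section Analytic.
Variables (R : realType) (I : finType) (a : I -> R).
Implicit Types (f g : (I -> R) -> R) (x : I -> R).

(** A finite weighted norm on a closed polydisc is what the algebra of [pseries_bound] preserves;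
    [analytic_near_at] converts to [analytic_at] only at the end. *)
Definition analytic_near f := exists r M, 0 < r /\ pseries_bound a r M f.

Lemma near_pt_le (r r' : R) x : r <= r' -> near_pt a r x -> near_pt a r' x.
Proof. by move=> rr' xr i; exact: le_trans (xr i) rr'. Qed.

Lemma near_pt_refl (r : R) : 0 < r -> near_pt a r a.
Proof. by move=> r0 i; rewrite subrr normr0 ltW. Qed.

Lemma analytic_ext f g (r : R) : 0 < r -> (forall x, near_pt a r x -> f x = g x) ->
  analytic_near f -> analytic_near g.
Proof.
move=> r0 fg [s [M [s0 fs]]]; pose q := Num.min r s.
have q0 : 0 < q by rewrite lt_min r0.
exists q, M; split=> //; apply: (@pseries_ext _ _ _ _ _ f).
  by move=> x xq; apply: fg; apply: near_pt_le xq; rewrite ge_min lexx.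
by apply: pseries_radius fs; rewrite q0 ge_min lexx orbT.
Qed.

Lemma analytic_eq f g : f =1 g -> analytic_near f -> analytic_near g.
Proof. by move=> fg; apply: (@analytic_ext f g 1) => // x _. Qed.

Lemma analytic_common (T : finType) (F : T -> (I -> R) -> R) : (forall t, analytic_near (F t)) ->
  exists r M, 0 < r /\ forall t, pseries_bound a r M (F t).
Proof.
move=> FA; suff [r [M [r0 h]]] : exists r M, 0 < r /\
    forall t, t \in enum T -> pseries_bound a r M (F t).
  by exists r, M; split=> // t; apply: h; rewrite mem_enum.
elim: (enum T) => [|t s [r [M [r0 h]]]]; first by exists 1, 1.
have [r' [M' [r'0 ht]]] := FA t; pose q := Num.min r r'.
have q0 : 0 < q by rewrite lt_min r0.
exists q, (Num.max M M'); split=> // u; rewrite inE => /predU1P[->|/h us].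
  apply: (@pseries_le _ _ _ _ M'); first by rewrite le_max lexx orbT.
  by apply: pseries_radius ht; rewrite q0 ge_min lexx orbT.
apply: (@pseries_le _ _ _ _ M); first by rewrite le_max lexx.
by apply: pseries_radius us; rewrite q0 ge_min lexx.
Qed.

Lemma analytic_common2 f g : analytic_near f -> analytic_near g ->
  exists r M N, [/\ 0 < r, pseries_bound a r M f & pseries_bound a r N g].
Proof.
move=> [r [M [r0 fr]]] [s [N [s0 gs]]]; exists (Num.min r s), M, N.
have q0 : 0 < Num.min r s by rewrite lt_min r0.
split=> //; [apply: pseries_radius fr|apply: pseries_radius gs].
  by rewrite q0 ge_min lexx.
by rewrite q0 ge_min lexx orbT.
Qed.

Lemma analytic_cst b : analytic_near (fun=> b).
Proof. by exists 1, `|b|; split=> //; exact: pseries_cst. Qed.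

Lemma analytic_add f g : analytic_near f -> analytic_near g -> analytic_near (fun x => f x + g x).
Proof.
move=> fA gA; have [r [M [N [r0 fr gr]]]] := analytic_common2 fA gA.
by exists r, (M + N); split=> //; exact: pseries_add.
Qed.

Lemma analytic_mul f g : analytic_near f -> analytic_near g -> analytic_near (fun x => f x * g x).
Proof.
move=> fA gA; have [r [M [N [r0 fr gr]]]] := analytic_common2 fA gA.
by exists r, (M * N); split=> //; exact: pseries_mul.
Qed.

Lemma analytic_scale b f : analytic_near f -> analytic_near (fun x => b * f x).
Proof. by move=> fA; apply: analytic_mul => //; exact: analytic_cst. Qed.

Lemma analytic_coord i : analytic_near (fun x => x i).
Proof.
apply: (@analytic_eq (fun x => (x i - a i) + a i)); first by move=> x; rewrite subrK.
apply: analytic_add; last exact: (analytic_cst (a i)).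
by exists 1, 1; split=> //; exact: (@pseries_coord _ _ a 1 i).
Qed.

Lemma analytic_sum (T : Type) (s : seq T) (P : pred T) (F : T -> (I -> R) -> R) :
  (forall t, analytic_near (F t)) -> analytic_near (fun x => \sum_(t <- s | P t) F t x).
Proof.
move=> FA; elim: s => [|t s IH].
  by apply: analytic_eq (analytic_cst 0) => x; rewrite big_nil.
by case Pt: (P t); [apply: analytic_eq (analytic_add (FA t) IH)|apply: analytic_eq IH] => x;
  rewrite big_cons Pt.
Qed.

Lemma analytic_prod (T : Type) (s : seq T) (P : pred T) (F : T -> (I -> R) -> R) :
  (forall t, analytic_near (F t)) -> analytic_near (fun x => \prod_(t <- s | P t) F t x).
Proof.
move=> FA; elim: s => [|t s IH].
  by apply: analytic_eq (analytic_cst 1) => x; rewrite big_nil.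
by case Pt: (P t); [apply: analytic_eq (analytic_mul (FA t) IH)|apply: analytic_eq IH] => x;
  rewrite big_cons Pt.
Qed.

Lemma analytic_small f (e : R) : 0 < e -> analytic_near f ->
  exists2 r, 0 < r & pseries_bound a r e (fun x => f x - f a).
Proof.
move=> e0 fA; have [r [M [r0 fr]]] := analytic_add fA (analytic_cst (- f a)).
have M1 : 0 < M + 1 by have := pseries_ge0 fr; lra.
(* The denominator [M + 1] is positive even when [M = 0], and the choice gives [q / r * M <= e]. *)
pose q := Num.min r (r * e / (M + 1)).
have q0 : 0 < q by rewrite lt_min r0 !mulr_gt0// invr_gt0.
exists q => //; have qr : 0 < q <= r by rewrite q0 ge_min lexx.
apply: pseries_le (pseries_shrink qr (subrr _) fr).
have -> : q / r * M = (q * M) / r by rewrite mulrAC.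
rewrite ler_pdivrMr//; apply: (@le_trans _ _ (q * (M + 1))).
  by rewrite ler_pM2l//; lra.
by rewrite -ler_pdivlMr// (mulrC e) ge_min lexx orbT.
Qed.

Lemma analytic_norm_le f (e : R) : 0 < e -> analytic_near f ->
  exists2 r, 0 < r & forall x, near_pt a r x -> `|f x - f a| <= e.
Proof.
move=> e0 /(analytic_small e0)[r r0 fr]; exists r => // x xr; exact: pseries_norm_le fr xr.
Qed.

(** On a polydisc where [f - f a] has norm at most [rho], its [k]-th power has norm at most
    [rho ^ k], so the terms are dominated by the series of [g] at [rho]. *)
Lemma analytic_comp (g : nat -> R) (rho : R) f : 0 < rho ->
  (nsum (fun k => g k * rho ^+ k)%R < +oo)%E -> analytic_near f ->
  analytic_near (fun x => rsum (fun k => g k * (f x - f a) ^+ k)).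
Proof.
move=> rho0 gfin /(analytic_small rho0)[r r0 fr].
have fin : (nsum (fun k => g k * rho ^+ k)%R =
    (fine (nsum (fun k => g k * rho ^+ k)%R))%:E)%E.
  by rewrite fineK// ge0_fin_numE// nsum_ge0.
exists r, (fine (nsum (fun k => g k * rho ^+ k))); split=> //.
apply: (@pseries_sum _ _ _ _ (fun k x => g k * (f x - f a) ^+ k)
  (fun k => `|g k| * rho ^+ k)) => //.
- move=> k; apply: pseries_scale; elim: k => [|k IH].
    by rewrite expr0; have := pseries_cst a 1 r0; rewrite normr1.
  rewrite exprS; apply: pseries_ext (pseries_mul r0 fr IH) => x _; by rewrite exprS.
- rewrite -fin; apply: le_esum => k _.
  by rewrite lee_fin normrM (ger0_norm (exprn_ge0 _ (ltW rho0))).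
Qed.

(** Geometric series in [- (f x - f a) / f a]; the bound [|f a| / 2] keeps the ratio at most
    [1 / 2]. *)
Lemma analytic_inv f : f a != 0 -> analytic_near f -> analytic_near (fun x => (f x)^-1).
Proof.
move=> fa0 fA; have n0 : 0 < `|f a| / 2 by rewrite divr_gt0 ?normr_gt0.
have [r r0 fr] := analytic_norm_le n0 fA.
pose g k := (f a)^-1 * (- (f a)^-1) ^+ k.
apply: (@analytic_ext (fun x => rsum (fun k => g k * (f x - f a) ^+ k)) _ r) => //.
  move=> x /fr xr; have z1 : `|- (f a)^-1 * (f x - f a)| < 1.
    rewrite normrM normrN normfV mulrC ltr_pdivrMr ?normr_gt0// mul1r.
    by apply: le_lt_trans xr _; lra.
  have [zf geo] := rsum_geometric z1.
  rewrite (@eq_rsum _ _ _ (fun k => (f a)^-1 * (- (f a)^-1 * (f x - f a)) ^+ k)).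
    rewrite rsumZ// geo -invfM; congr _^-1.
    by rewrite mulNr opprK mulrDr mulr1 mulVKf// addrC subrK.
  by move=> k; rewrite /g -mulrA exprMn.
apply: (analytic_comp n0) => //.
have [|zf _] := @rsum_geometric R (1 / 2); first by rewrite ger0_norm; lra.
have := nsumZ_lty (f a)^-1 zf; apply: le_lt_trans; apply: le_nsum => k.
rewrite /g -mulrA !normrM ler_wpM2l// -normrM -exprMn normrX normrM normrN normfV.
rewrite (ger0_norm (ltW n0)) mulrA mulVf ?normr_eq0// mul1r.
by rewrite ger0_norm// exprn_ge0//; lra.
Qed.

(** Here [ln (f x) = ln (f a) + ln (1 + (f x - f a) / f a)], and the quotient is kept at most
    [1 / 2] in absolute value, within reach of [ln_series]. *)
Lemma analytic_ln f : 0 < f a -> analytic_near f -> analytic_near (fun x => ln (f x)).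
Proof.
move=> fa0 fA; have n0 : 0 < f a / 2 by rewrite divr_gt0.
have [r r0 fr] := analytic_norm_le n0 fA.
pose g k := ln_coef R k * (f a)^-1 ^+ k.
apply: (@analytic_ext (fun x => ln (f a) + rsum (fun k => g k * (f x - f a) ^+ k)) _ r) => //.
  move=> x /fr xr; have z1 : `|(f a)^-1 * (f x - f a)| < 3 / 4.
    rewrite normrM normfV (gtr0_norm fa0) mulrC ltr_pdivrMr//.
    by apply: le_lt_trans xr _; lra.
  have := ln_series z1; rewrite (@eq_rsum _ _ _ (fun k => g k * (f x - f a) ^+ k)).
    move=> <-; rewrite -lnM ?posrE//.
      by rewrite mulrDr mulr1 mulVKf ?gt_eqF// addrC subrK.
    by move: z1; rewrite ltr_norml; lra.
  by move=> k; rewrite /g -mulrA exprMn.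
apply: analytic_add; first exact: analytic_cst.
apply: (analytic_comp n0) => //.
have h1 : `|1 / 2 : R| < 1 by rewrite ger0_norm; lra.
have := nsum_bounded_coef (@norm_ln_coef R) h1.
congr (_ < _)%E; apply: eq_nsum => k.
rewrite /g -mulrA -exprMn; congr (_ * _ ^+ _).
by rewrite mulrA mulVf ?gt_eqF.
Qed.

Lemma analytic_near_at f : analytic_near f -> analytic_at f a.
Proof.
move=> [r [M [r0 [c cM fE]]]]; exists c, r; split=> // x xr.
have xr' : near_pt a r x by move=> i; exact: ltW.
rewrite fE//; apply: cvg_rsum; apply: le_lt_trans (ltry M).
apply: le_trans cM; exact: nsum_mono_le.
Qed.

End Analytic.

(** * Cauchy products *)

Lemma esum_nsum_dom (R : realType) (J K : choiceType) (x : J -> K -> R) u v :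
  (forall j k, `|x j k| <= `|u j * v k|) ->
  (nsum u < +oo)%E -> (nsum v < +oo)%E ->
  (\esum_(j in [set: J]) nsum (x j) < +oo)%E.
Proof.
move=> xuv fu fv.
have ve : nsum v = (fine (nsum v))%:E by rewrite fineK// ge0_fin_numE ?nsum_ge0.
have v0 : 0 <= fine (nsum v) by rewrite fine_ge0// nsum_ge0.
have := nsumZ_lty (fine (nsum v)) fu; apply: le_lt_trans.
apply: le_esum => j _; rewrite normrM ger0_norm// mulrC EFinM -ve.
apply: le_trans (nsumZ _ _); exact: le_nsum.
Qed.

(** Row [k] is delayed by [k] places; after the interchange, column [m] meets only the rows
    [k <= m]. *)
Lemma rsum_cauchy (R : realType) (x : nat -> nat -> R) :
  (\esum_(k in [set: nat]) nsum (x k) < +oo)%E ->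
  rsum (fun k => rsum (x k)) = rsum (fun m => \sum_(k < m.+1) x k (m - k)%N).
Proof.
move=> fx; have fk := nsum_term_lty fx.
pose z k m := if (k <= m)%N then x k (m - k)%N else 0.
have zk k : rsum (z k) = rsum (x k) by rewrite rsum_shift.
rewrite -(eq_rsum zk) rsum_swap; last first.
  by under eq_esum do rewrite nsum_shift.
apply: eq_rsum => m; have [k|_ ->] := @rsum_ord R (z^~ m) m.+1.
  by rewrite /z ltnNge => /negbTE ->.
by apply: eq_bigr => k _; rewrite /z -ltnS ltn_ord.
Qed.

(** * The matrix exponential *)

Section MatrixExp.
Variable R : realType.

Lemma cvg_mx m n (F : nat -> 'M[R]_(m, n)) (L : 'M[R]_(m, n)) :
  (forall i j, (fun k => F k i j) @ \oo --> L i j) -> F @ \oo --> L.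
Proof.
move=> FL A [P PL PA].
have : \forall k \near \oo, forall i j, P i j (F k i j).
  by apply: filter_forall => i; apply: filter_forall => j; exact: FL (PL i j).
by apply: filterS => k; exact: PA.
Qed.

Lemma exprSmx n (A : 'M[R]_n) k : A ^+ k.+1 = A *m A ^+ k.
Proof. exact: exprS. Qed.

Lemma norm_exprmx_le n (A : 'M[R]_n) M k i j : (forall i j, `|A i j| <= M) ->
  `|(A ^+ k) i j| <= (n%:R * M) ^+ k.
Proof.
move=> AM; elim: k i j => [|k IH] i j.
  by rewrite !expr0 mxE; case: (i == j); rewrite ?normr1 ?normr0.
rewrite exprSmx mxE exprS; apply: (le_trans (ler_norm_sum _ _ _)).
apply: (@le_trans _ _ (\sum_(p < n) M * (n%:R * M) ^+ k)).
  by apply: ler_sum => p _; rewrite normrM ler_pM.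
by rewrite sumr_const card_ord -[leLHS]mulr_natl mulrA.
Qed.

Lemma nsum_exp_coeff (x : R) : (nsum (fun k => (k`!%:R^-1 * x ^+ k)%R) < +oo)%E.
Proof.
have /cvg_ex[l xl] := is_cvg_series_exp_coeff `|x|.
apply: nsum_dom xl => k; rewrite normrM normrX normfV normr_nat.
by rewrite /exp_coeff/= mulrC.
Qed.

Lemma entry_le_sum m n (A : 'M[R]_(m, n)) i j :
  `|A i j| <= \sum_i \sum_j `|A i j|.
Proof.
rewrite (bigD1 i)//= (bigD1 j)//= -addrA lerDl addr_ge0 ?sumr_ge0// => p _.
exact: sumr_ge0.
Qed.

Lemma expmx_dom n (A : 'M[R]_n) : exists2 c : R, 0 <= c &
  forall k i j, `|(A ^+ k) i j| <= c ^+ k.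
Proof.
exists (n%:R * \sum_i \sum_j `|A i j|).
  by rewrite mulr_ge0// sumr_ge0// => i _; rewrite sumr_ge0.
by move=> k i j; apply: norm_exprmx_le => {}i {}j; exact: entry_le_sum.
Qed.

Lemma nsum_expmx n (A : 'M[R]_n) i j :
  (nsum (fun k => (k`!%:R^-1 * (A ^+ k) i j)%R) < +oo)%E.
Proof.
have [c c0 Ac] := expmx_dom A; apply: le_lt_trans (nsum_exp_coeff c).
apply: le_nsum => k; rewrite !normrM ler_wpM2l//.
by rewrite (le_trans (Ac k i j))// ler_norm.
Qed.

(** Replaces the limit in the matrix topology by unconditional sums of entries, on which the later
    results about [expmx] are based. *)
Lemma expmxE n (A : 'M[R]_n) i j :
  expmx A i j = rsum (fun k => k`!%:R^-1 * (A ^+ k) i j).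
Proof.
have -> : expmx A = \matrix_(i, j) rsum (fun k => k`!%:R^-1 * (A ^+ k) i j).
  apply: cvg_lim; first exact: norm_hausdorff.
  apply: cvg_mx => {}i {}j; rewrite mxE.
  rewrite (_ : (fun k => _) = series (fun k => k`!%:R^-1 * (A ^+ k) i j)).
    exact: cvg_series_rsum (nsum_expmx A i j).
  by apply/funext => k; rewrite /series/= summxE; apply: eq_bigr => l _; rewrite mxE.
by rewrite mxE.
Qed.

Lemma rsum_sum (T : choiceType) p (x : 'I_p -> T -> R) :
  (forall i, nsum (x i) < +oo)%E ->
  (nsum (fun t => \sum_i x i t)%R < +oo)%E /\
  rsum (fun t => \sum_i x i t) = \sum_i rsum (x i).
Proof.
elim: p x => [|p IH] x fx.
  have := @rsum_fset R T (fun t => \sum_(i < 0) x i t) fset0; rewrite big_ord0.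
  by rewrite big_seq_fset0; apply=> i _; rewrite big_ord0.
have [|f e] := IH (fun i => x (lift ord0 i)); first by move=> i; exact: fx.
rewrite (_ : (fun t => _) = fun t => x ord0 t + \sum_i x (lift ord0 i) t).
  by split; [exact: nsumD_lty|rewrite rsumD// e big_ord_recl].
by apply/funext => t; rewrite big_ord_recl.
Qed.

Lemma mulmx_expmxE m n (C : 'M[R]_(m, n)) (A : 'M[R]_n) i j :
  (nsum (fun k => (k`!%:R^-1 * (C *m A ^+ k) i j)%R) < +oo)%E /\
  (C *m expmx A) i j = rsum (fun k => k`!%:R^-1 * (C *m A ^+ k) i j).
Proof.
rewrite (_ : (fun k => _) = fun k : nat =>
    \sum_p C i p * (k`!%:R^-1 * (A ^+ k) p j)); last first.
  apply/funext => k; rewrite mxE mulr_sumr; apply: eq_bigr => p _.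
  by rewrite mulrCA.
have [|f ->] := rsum_sum (x := fun p k => C i p * (k`!%:R^-1 * (A ^+ k) p j)).
  by move=> p; apply: nsumZ_lty; exact: nsum_expmx.
split=> //; rewrite mxE; apply: eq_bigr => p _.
by rewrite expmxE rsumZ//; exact: nsum_expmx.
Qed.

Lemma expmx_mulmxE m n (C : 'M[R]_(n, m)) (A : 'M[R]_n) i j :
  (expmx A *m C) i j = rsum (fun k => k`!%:R^-1 * (A ^+ k *m C) i j).
Proof.
rewrite (@eq_rsum _ _ _ (fun k : nat =>
    \sum_p C p j * (k`!%:R^-1 * (A ^+ k) i p))); last first.
  move=> k; rewrite mxE mulr_sumr; apply: eq_bigr => p _.
  by rewrite mulrA mulrC.
have [|f ->] := rsum_sum (x := fun p k => C p j * (k`!%:R^-1 * (A ^+ k) i p)).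
  by move=> p; apply: nsumZ_lty; exact: nsum_expmx.
rewrite mxE; apply: eq_bigr => p _.
by rewrite mulrC expmxE rsumZ//; exact: nsum_expmx.
Qed.

(* With [C] a rectangular block matrix, this computes the blocks of [expmx]. *)
Lemma expmx_intertwine m n (C : 'M[R]_(m, n)) (X : 'M[R]_n) (Y : 'M[R]_m) :
  C *m X = Y *m C -> C *m expmx X = expmx Y *m C.
Proof.
move=> CXY; have CXYk k : C *m X ^+ k = Y ^+ k *m C.
  elim: k => [|k IH]; first by rewrite !expr0 mulmx1 mul1mx.
  by rewrite !exprSmx mulmxA CXY -mulmxA IH mulmxA.
apply/matrixP => i j; have [_ ->] := mulmx_expmxE C X i j.
by rewrite expmx_mulmxE; apply: eq_rsum => k; rewrite CXYk.
Qed.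

Lemma expmxD n (X Y : 'M[R]_n) : X *m Y = Y *m X ->
  expmx (X + Y) = expmx X *m expmx Y.
Proof.
move=> XY; apply/matrixP => i j.
have [c c0 Xc] := expmx_dom X; have [d d0 Yd] := expmx_dom Y.
(* The index [k] counts powers of [Y] and [l] powers of [X], so that the antidiagonal [l = m - k]
   yields the binomial term [X^(m-k) Y^k] of [exprDn_comm]. *)
pose x k l := k`!%:R^-1 * (l`!%:R^-1 * (X ^+ l *m Y ^+ k) i j).
have xle k l : `|x k l| <= `|n%:R * (k`!%:R^-1 * d ^+ k) * (l`!%:R^-1 * c ^+ l)|.
  have XYle : `|(X ^+ l *m Y ^+ k) i j| <= n%:R * (c ^+ l * d ^+ k).
    rewrite mxE; apply: (le_trans (ler_norm_sum _ _ _)).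
    apply: (@le_trans _ _ (\sum_(p < n) c ^+ l * d ^+ k)).
      by apply: ler_sum => p _; rewrite normrM ler_pM.
    by rewrite sumr_const card_ord mulr_natl.
  have u0 : 0 <= k`!%:R^-1 :> R by [].
  have v0 : 0 <= l`!%:R^-1 :> R by [].
  rewrite /x; move: k`!%:R^-1 l`!%:R^-1 u0 v0 => u v u0 v0.
  rewrite [leLHS]normrM [X in _ * X]normrM [leRHS]ger0_norm; last first.
    by rewrite !mulr_ge0// ?exprn_ge0.
  rewrite (ger0_norm u0) (ger0_norm v0).
  rewrite [leRHS](_ : _ = u * (v * (n%:R * (c ^+ l * d ^+ k)))); last by ring.
  by rewrite !ler_wpM2l.
have fx : (\esum_(k in [set: nat]) nsum (x k) < +oo)%E.
  apply: (esum_nsum_dom xle) (nsum_exp_coeff c).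
  exact: nsumZ_lty (nsum_exp_coeff d).
have [_ ->] := mulmx_expmxE (expmx X) Y i j.
rewrite (@eq_rsum _ _ _ (fun k : nat => rsum (x k))); last first.
  move=> k; rewrite expmx_mulmxE rsumZ//.
  have := nsumZ_lty (k`!%:R) (nsum_term_lty fx k); congr (_ < _)%E.
  by apply: eq_nsum => l; rewrite /x mulVKf// pnatr_eq0 -lt0n fact_gt0.
rewrite rsum_cauchy// expmxE; apply: eq_rsum => m.
rewrite (exprDn_comm _ XY) summxE mulr_sumr; apply: eq_bigr => k _.
rewrite /x [LHS](_ : _ = m`!%:R^-1 * 'C(m, k)%:R * (X ^+ (m - k) *m Y ^+ k) i j).
  rewrite mulrA; congr (_ * _).
  have km : (k <= m)%N by rewrite -ltnS.
  rewrite -(bin_fact km) !natrM.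
  have f0 (l : nat) : (l`!%:R : R) != 0 by rewrite pnatr_eq0 -lt0n fact_gt0.
  have C0 : ('C(m, k)%:R : R) != 0 by rewrite pnatr_eq0 -lt0n bin_gt0.
  by field; rewrite !f0 C0.
by rewrite -mulrA; congr (_ * _); rewrite mulmxnE mulr_natl.
Qed.

End MatrixExp.

(** * Logarithms of upper triangular matrices *)

Section LogUT.
Variable R : realType.

Lemma utP n (A : 'M[R]_n) : ut A <-> forall i j : 'I_n, (j < i)%N -> A i j = 0.
Proof.
split=> [/is_trig_mxP h i j ji|h]; first by have := h j i ji; rewrite mxE.
by apply/is_trig_mxP => i j ij; rewrite mxE h.
Qed.

Lemma ut_mulmx n (A B : 'M[R]_n) : ut A -> ut B -> ut (A *m B).
Proof.
move=> /utP hA /utP hB; apply/utP => i j ji; rewrite mxE big1// => p _.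
have [pi|ip] := ltnP p i; first by rewrite hA// mul0r.
by rewrite hB ?mulr0// (leq_trans ji).
Qed.

Lemma UT_mulmx n (A B : 'M[R]_n) : UT A -> UT B -> UT (A *m B).
Proof.
move=> [utA A0] [utB B0]; split; first exact: ut_mulmx.
move: utA utB => /utP hA /utP hB i; rewrite mxE (bigD1 i)//= big1 ?addr0.
  by rewrite mulr_gt0.
move=> p pi; have [lt|] := ltnP p i; first by rewrite hA// mul0r.
by rewrite leq_eqVlt -[i == p :> nat]/(i == p) eq_sym (negbTE pi) => /hB ->; rewrite mulr0.
Qed.

Lemma UT_unitmx n (A : 'M[R]_n) : UT A -> A \in unitmx.
Proof.
move=> [utA A0]; rewrite unitmxE unitfE -det_tr det_trig// prodf_seq_neq0.
by apply/allP => i _ /=; rewrite mxE gt_eqF.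
Qed.

Lemma utZ n (s : R) (A : 'M[R]_n) : ut A -> ut (s *: A).
Proof. by move=> /utP hA; apply/utP => i j ji; rewrite mxE hA// mulr0. Qed.

Lemma ut_block n (a : 'M[R]_1) (v : 'rV[R]_n) (A : 'M[R]_n) :
  ut (block_mx a v 0 A : 'M[R]_(1 + n)) <-> ut A.
Proof.
rewrite /ut/= tr_block_mx is_trig_block_mx// trmx0 eqxx/=.
by rewrite mx11_is_trig.
Qed.

Lemma UT_block n (a : 'M[R]_1) (v : 'rV[R]_n) (A : 'M[R]_n) :
  UT (block_mx a v 0 A : 'M[R]_(1 + n)) <-> 0 < a 0 0 /\ UT A.
Proof.
split=> [[/ut_block utA d]|[a0 [utA d]]].
  split; first by have := d (lshift n 0); rewrite block_mxEul.
  by split=> // i; have := d (rshift 1 i); rewrite block_mxEdr.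
split; first exact/ut_block.
move=> i; case: (split_ordP i) => k ->; last by rewrite block_mxEdr.
by rewrite block_mxEul ord1.
Qed.

Lemma ut_blockE n (A : 'M[R]_(1 + n)) : ut A ->
  A = block_mx (A 0 0)%:M (ursubmx A) 0 (drsubmx A).
Proof.
move=> /utP hA; rewrite -[LHS]submxK; congr (block_mx _ _ _ _).
  by rewrite [LHS]mx11_scalar; congr (_%:M); rewrite !mxE; congr (A _ _); exact/val_inj.
by apply/matrixP => i j; rewrite !mxE hA//= ltn_addr.
Qed.

Lemma ut_blockP n (A : 'M[R]_n.+1) : ut A -> exists a u B,
  A = block_mx (a%:M : 'M[R]_1) u 0 B :> 'M[R]_(1 + n) /\ ut B.
Proof.
move=> utA; have AE := ut_blockE (utA : ut (A : 'M[R]_(1 + n))).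
do 3!eexists; split; first exact: AE.
by move: utA; rewrite {1}AE => /ut_block.
Qed.

Lemma expmx0 n : expmx (0 : 'M[R]_n) = 1%:M.
Proof.
apply/matrixP => i j; rewrite expmxE.
have [k k0|_ ->] := @rsum_single R _ (fun k => k`!%:R^-1 * ((0 : 'M[R]_n) ^+ k) i j) 0%N.
  by rewrite expr0n (negbTE k0) mxE mulr0.
by rewrite expr0 invr1 mul1r.
Qed.

Lemma expmx_scalar n (a : R) : expmx (a%:M : 'M[R]_n) = (expR a)%:M.
Proof.
have Xk k : (a%:M : 'M[R]_n) ^+ k = (a ^+ k)%:M.
  by elim: k => [//|k IH]; rewrite exprSmx IH exprS scalar_mxM.
apply/matrixP => i j; rewrite expmxE mxE.
rewrite (@eq_rsum _ _ _ (fun k : nat => (i == j)%:R * (k`!%:R^-1 * a ^+ k))).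
  rewrite rsumZ ?nsum_exp_coeff// -[RHS]mulr_natl; congr (_ * _).
  apply: rsum_nat; first exact: nsum_exp_coeff.
  rewrite (_ : (fun k => _) = exp_coeff a); first exact: is_cvg_series_exp_coeff.
  by apply/funext => k; rewrite exp_coeffE.
by move=> k; rewrite Xk mxE -[_ *+ (i == j)]mulr_natl mulrCA.
Qed.

(** The inclusion of the first block and the projection onto the second intertwine the block matrix
    with [A] and [X]; this fixes every block but the upper right one. *)
Lemma expmx_ublock m n (A : 'M[R]_m) (V : 'M[R]_(m, n)) (X : 'M[R]_n) :
  expmx (block_mx A V 0 X) =
  block_mx (expmx A) (ursubmx (expmx (block_mx A V 0 X))) 0 (expmx X).
Proof.
set Z := block_mx _ _ _ _; set E := expmx Z.
have cZ : col_mx 1%:M 0 *m A = Z *m col_mx 1%:M 0.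
  by rewrite mul_block_col mul_col_mx !mulmx1 !mulmx0 !mul0mx mul1mx !addr0.
have rZ : row_mx 0 1%:M *m Z = X *m row_mx 0 1%:M.
  by rewrite mul_row_block mul_mx_row !mulmx1 !mulmx0 !mul0mx !mul1mx !add0r.
have := expmx_intertwine rZ; have := expmx_intertwine cZ; rewrite -/E.
rewrite -{1 2}[E]submxK.
rewrite mul_block_col mul_col_mx mul_row_block mul_mx_row.
rewrite !mulmx1 !mulmx0 !mul0mx !mul1mx !add0r !addr0.
move=> /eq_col_mx[-> dl0] /eq_row_mx[_ <-].
by rewrite -[LHS]submxK -dl0.
Qed.

(* The divided difference of the exponential at [mu] and [X]: formally,
   [(expmx X - expR mu) / (X - mu)]. *)
Definition divdiff_mx n (mu : R) (X : 'M[R]_n) : 'M[R]_n :=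
  ursubmx (expmx (block_mx mu%:M 1%:M 0 X : 'M[R]_(n + n))).

Lemma divdiff_intertwine m n mu (C : 'M[R]_(m, n)) (X : 'M[R]_n) (Y : 'M[R]_m) :
  C *m X = Y *m C -> C *m divdiff_mx mu X = divdiff_mx mu Y *m C.
Proof.
move=> CXY; have CZ : block_mx C 0 0 C *m block_mx mu%:M 1%:M 0 X =
    block_mx mu%:M 1%:M 0 Y *m block_mx C 0 0 C.
  rewrite !mulmx_block !mulmx0 !mul0mx !mulmx1 !mul1mx !addr0 !add0r CXY.
  by rewrite mul_mx_scalar mul_scalar_mx.
have := expmx_intertwine CZ; rewrite expmx_ublock [in RHS]expmx_ublock.
rewrite !mulmx_block !mulmx0 !mul0mx !addr0 !add0r.
by move=> /eq_block_mx[_ -> _ _].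
Qed.

(** The block diagonal matrix of [v] and [1] intertwines the doubled matrix defining [divdiff_mx]
    with this one, so [v] factors out of the upper right block. *)
Lemma expmx_block n mu (v : 'rV[R]_n) (X : 'M[R]_n) :
  expmx (block_mx mu%:M v 0 X : 'M[R]_(1 + n)) =
  block_mx (expR mu)%:M (v *m divdiff_mx mu X) 0 (expmx X).
Proof.
have CZ : block_mx v 0 0 1%:M *m block_mx mu%:M 1%:M 0 X =
    block_mx mu%:M v 0 X *m block_mx v 0 0 1%:M.
  rewrite !mulmx_block !mulmx0 !mul0mx !mulmx1 !mul1mx !addr0 !add0r.
  by rewrite mul_mx_scalar mul_scalar_mx.
have := expmx_intertwine CZ; rewrite expmx_ublock [in RHS]expmx_ublock.
rewrite !mulmx_block !mulmx0 !mul0mx !mulmx1 !addr0 !add0r.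
move=> /eq_block_mx[_ + _ _]; rewrite -/(divdiff_mx mu X) => ->.
by rewrite [LHS]expmx_ublock expmx_scalar.
Qed.

(** Upper right block of [Z exp Z = exp Z Z], where [Z] is the doubled matrix. *)
Lemma divdiff_comm n mu (X : 'M[R]_n) :
  divdiff_mx mu X *m X - mu *: divdiff_mx mu X = expmx X - (expR mu)%:M.
Proof.
have := expmx_intertwine (erefl (block_mx mu%:M 1%:M 0 X *m block_mx mu%:M 1%:M 0 X)).
rewrite expmx_ublock expmx_scalar -/(divdiff_mx mu X) !mulmx_block.
rewrite !mulmx0 !mul0mx !mulmx1 !mul1mx !addr0 !add0r => /eq_block_mx[_ + _ _].
rewrite mul_scalar_mx => e; apply/eqP; rewrite subr_eq addrAC eq_sym subr_eq.
by rewrite addrC e addrC.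
Qed.

(** For [x] distinct from [mu], vanishing would force [exp x = exp mu]. For [x = mu], the doubled
    matrix is a Jordan block [mu + N] with [N^2 = 0], and the entry is [exp mu]. *)
Lemma divdiff_scalar_neq0 mu x : divdiff_mx mu (x%:M : 'M[R]_1) 0 0 != 0.
Proof.
have [->|mux] := eqVneq x mu; last first.
  apply/eqP; have := divdiff_comm mu (x%:M : 'M[R]_1).
  move: (divdiff_mx mu _) => P + p0; move=> /matrixP/(_ 0 0); rewrite expmx_scalar mul_mx_scalar !mxE p0 !mulr0.
  rewrite subr0 eqxx !mulr1n => /esym/subr0_eq/expR_inj e.
  by rewrite e eqxx in mux.
pose N : 'M[R]_(1 + 1) := block_mx 0 1%:M 0 0.
have ZE : block_mx mu%:M 1%:M 0 mu%:M = mu%:M + N.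
  by rewrite /N scalar_mx_block add_block_mx !addr0 !add0r.
rewrite /divdiff_mx ZE expmxD ?scalar_mxC// expmx_scalar mul_scalar_mx !mxE.
rewrite mulf_neq0// ?gt_eqF ?expR_gt0// expmxE.
have N2 : N *m N = 0.
  by rewrite mulmx_block !mulmx0 !mul0mx !addr0 block_mx0.
have [k|_ ->] := @rsum_single R _ (fun k => k`!%:R^-1 * (N ^+ k) (lshift 1 0) (rshift 1 0)) 1%N.
  case: k => [_|[//|k _]]; first by rewrite expr0 mxE mulr0.
  by rewrite !exprSmx mulmxA N2 mul0mx mxE mulr0.
by rewrite expr1 invr1 mul1r block_mxEur mxE.
Qed.

(** The inclusion of the first coordinate and the projection onto the others intertwine [X] with [x]
    and [X']. Hence the divided difference is block triangular, with those of [x] and [X'] on its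
    diagonal. *)
Lemma det_divdiff_neq0 n mu (X : 'M[R]_n) : ut X -> \det (divdiff_mx mu X) != 0.
Proof.
elim: n X => [|n IH] X; first by rewrite det_mx00 oner_neq0.
move=> /ut_blockP[x [w [X' [-> utX]]]]; rewrite -[n.+1]/(1 + n)%N.
have rX : row_mx 0 1%:M *m block_mx x%:M w 0 X' = X' *m row_mx 0 1%:M.
  by rewrite mul_row_block mul_mx_row !mulmx1 !mulmx0 !mul0mx !mul1mx !add0r.
have cX : col_mx 1%:M 0 *m x%:M = block_mx x%:M w 0 X' *m col_mx 1%:M 0.
  by rewrite mul_block_col mul_col_mx !mulmx1 !mulmx0 !mul0mx mul1mx !addr0.
have := divdiff_intertwine mu rX; have := divdiff_intertwine mu cX.
set P := divdiff_mx mu (block_mx _ _ _ _).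
rewrite -{1 2}[P]submxK.
rewrite mul_block_col mul_col_mx mul_row_block mul_mx_row.
rewrite !mulmx1 !mulmx0 !mul0mx !mul1mx !add0r !addr0.
move=> /eq_col_mx[ul dl0] /eq_row_mx[_ dr].
rewrite -[P]submxK -dl0 det_ublock -ul dr mulf_neq0 ?IH//.
by rewrite det_mx11 divdiff_scalar_neq0.
Qed.

Lemma expmx_UT n (X : 'M[R]_n) : ut X -> UT (expmx X).
Proof.
elim: n X => [|n IH] X utX.
  by split=> [|[]//]; apply/utP => -[].
move: utX => /ut_blockP[x [w [X' [-> /IH UTX]]]].
rewrite expmx_block; apply/UT_block.
by split=> //; rewrite mxE mulr1n expR_gt0.
Qed.

Lemma divdiff_unitmx n mu (X : 'M[R]_n) : ut X -> divdiff_mx mu X \in unitmx.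
Proof. by move=> utX; rewrite unitmxE unitfE det_divdiff_neq0. Qed.

Lemma expmx_inj n (X Y : 'M[R]_n) : ut X -> ut Y -> expmx X = expmx Y -> X = Y.
Proof.
elim: n X Y => [|n IH] X Y utX utY; first by rewrite [X]flatmx0 [Y]flatmx0.
move: utX utY => /ut_blockP[x [v [X' [-> utX]]]] /ut_blockP[y [w [Y' [-> utY]]]].
rewrite !expmx_block => e.
have [e1 e2 _ e3] := eq_block_mx (e : _ = _ :> 'M[R]_(1 + n)).
have xy : x = y.
  by move: e1 => /(congr1 (fun M : 'M[R]_1 => M 0 0)); rewrite !mxE !mulr1n => /expR_inj.
have XY := IH _ _ utX utY e3; rewrite XY xy in e2 *.
by rewrite -[v](mulmxK (divdiff_unitmx y utY)) e2 mulmxK// divdiff_unitmx.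
Qed.

Lemma logmx_unique n (A X : 'M[R]_n) : ut X -> expmx X = A -> logmx A = X.
Proof.
move=> utX XA; apply: xget_unique => [//|Y [utY YA]].
by apply: expmx_inj => //; rewrite YA.
Qed.

(** The hypotheses speak of [logmx A] rather than of [UT A], so that the recursion serves inside the
    proof of [logmxP] as well as after it. *)
Lemma logmx_block n (a : R) (u : 'rV[R]_n) (A : 'M[R]_n) :
  0 < a -> ut (logmx A) -> expmx (logmx A) = A ->
  let L := block_mx (ln a)%:M (u *m invmx (divdiff_mx (ln a) (logmx A))) 0 (logmx A) in
  ut (L : 'M[R]_(1 + n)) /\ expmx (L : 'M[R]_(1 + n)) = block_mx a%:M u 0 A.
Proof.
move=> a0 utL EL /=; split; first exact/ut_block.
by rewrite expmx_block lnK ?posrE// mulmxKV ?divdiff_unitmx// EL.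
Qed.

Lemma logmxP n (A : 'M[R]_n) : UT A -> ut (logmx A) /\ expmx (logmx A) = A.
Proof.
suff : UT A -> exists2 X, ut X & expmx X = A.
  by move=> h /h[X utX XA]; rewrite (logmx_unique utX XA).
elim: n A => [|n IH] A UTA.
  by exists A; [case: UTA|rewrite [LHS]flatmx0 [RHS]flatmx0].
have /ut_blockP[a [u [B [AE _]]]] := UTA.1.
move: UTA; rewrite AE => /UT_block[]; rewrite mxE mulr1n => a0 /IH[X utX XB].
(* Once the lower block is written [expmx X], [logmx_unique] evaluates its logarithm. *)
rewrite -XB; have [||utL EL] := @logmx_block n _ u (expmx X) a0.
- by rewrite (logmx_unique utX).
- by rewrite (logmx_unique utX).
- by eexists; [exact: utL|exact: EL].
Qed.

End LogUT.

(** * Real powers and Karcher means *)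

Section Powers.
Variables (R : realType) (n : nat).
Implicit Types (A P X : 'M[R]_n) (s t : R).

Lemma powmx_UT A s : UT A -> UT (powmx A s).
Proof. by move=> /logmxP[utL _]; exact/expmx_UT/utZ. Qed.

Lemma powmxD A s t : powmx A (s + t) = powmx A s *m powmx A t.
Proof.
by rewrite /powmx scalerDl expmxD// -!scalemxAl -!scalemxAr scalerA mulrC -scalerA.
Qed.

Lemma powmx0 A : powmx A 0 = 1%:M.
Proof. by rewrite /powmx scale0r expmx0. Qed.

Lemma powmx1 A : UT A -> powmx A 1 = A.
Proof. by move=> /logmxP[_ LA]; rewrite /powmx scale1r. Qed.

Lemma powmxN A s : powmx A (- s) = invmx (powmx A s).
Proof.
have e : powmx A s *m powmx A (- s) = 1%:M by rewrite -powmxD subrr powmx0.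
have [u _] := mulmx1_unit e.
by rewrite -[LHS](mulKmx u) e mulmx1.
Qed.

(** The inverse is the power of exponent -1, hence an exponential of a triangular matrix. *)
Lemma UT_invmx A : UT A -> UT (invmx A).
Proof. by move=> UTA; rewrite -{1}(powmx1 UTA) -powmxN; exact: powmx_UT. Qed.

Lemma logmx_powmx A s : UT A -> logmx (powmx A s) = s *: logmx A.
Proof. by move=> /logmxP[utL _]; apply: logmx_unique => //; exact: utZ. Qed.

(** Conjugation commutes with [expmx], and for triangular [P] the conjugate of [logmx A] stays in
    [ut]; by uniqueness it is the logarithm of the conjugate. *)
Lemma powmx_conj P A s : UT P -> UT A ->
  powmx (P *m A *m invmx P) s = P *m powmx A s *m invmx P.
Proof.
move=> UTP UTA; have uP := UT_unitmx UTP; have [utL LA] := logmxP UTA.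
have expC X : expmx (P *m X *m invmx P) = P *m expmx X *m invmx P.
  rewrite (@expmx_intertwine _ _ _ P X (P *m X *m invmx P)) ?mulmxK//.
  by rewrite mulmxKV.
have utLP : ut (P *m logmx A *m invmx P).
  by apply: ut_mulmx (UT_invmx UTP).1; exact: ut_mulmx UTP.1 utL.
rewrite /powmx (@logmx_unique _ _ _ (P *m logmx A *m invmx P))//.
  by rewrite scalemxAl scalemxAr expC.
by rewrite expC LA.
Qed.

Lemma karcher_mean_iff t A1 A2 X : 0 < t -> t < 1 -> UT A1 -> UT A2 ->
  is_karcher_mean [tuple 1 - t; t] [tuple A1; A2] X <->
  X = A1 *m powmx (invmx A1 *m A2) t.
Proof.
move=> t0 t1 U1 U2; have u1 := UT_unitmx U1; have u2 := UT_unitmx U2.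
set P := invmx A1 *m A2; have UP : UT P by apply: UT_mulmx => //; exact: UT_invmx.
have sumE Y : \sum_(i < 2) tnth [tuple 1 - t; t] i *:
    logmx (invmx Y *m tnth [tuple A1; A2] i) =
    (1 - t) *: logmx (invmx Y *m A1) + t *: logmx (invmx Y *m A2).
  by rewrite big_ord_recl big_ord1.
split=> [[_ _ UX]|->].
  rewrite sumE => e; have uX := UT_unitmx UX.
  have t1' : 1 - t != 0 by rewrite subr_eq0 gt_eqF.
  have UV : UT (invmx X *m A2) by apply: UT_mulmx => //; exact: UT_invmx.
  have UU : UT (invmx X *m A1) by apply: UT_mulmx => //; exact: UT_invmx.
  (* The Karcher equation solved for the logarithm of [X^-1 A1], then exponentiated. *)
  have UE : invmx X *m A1 = powmx (invmx X *m A2) (- (t / (1 - t))).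
    have [_ <-] := logmxP UU; congr expmx; apply: (scalerI t1').
    rewrite scalerA mulrN mulrC divfK// scaleNr; apply/eqP.
    by rewrite -addr_eq0 e.
  (* The exponent equals [1 / (1 - t)], so raising to the power [t] gives the exponent [t / (1 - t)]
     of the inverse of [X^-1 A1]. *)
  have PE : P = powmx (invmx X *m A2) (t / (1 - t) + 1).
    rewrite powmxD powmx1// -[t / (1 - t)]opprK powmxN -UE.
    have -> : invmx X *m A2 = invmx X *m A1 *m P by rewrite /P -mulmxA mulKVmx.
    by rewrite mulKmx// UT_unitmx.
  have -> : powmx P t = invmx (invmx X *m A1).
    rewrite PE /powmx logmx_powmx// scalerA -/(powmx _ _).
    rewrite (_ : t * _ = t / (1 - t)); last by field.
    by rewrite -[t / (1 - t)]opprK powmxN -UE.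
  by rewrite -{1}(mulKVmx uX A1) mulmxK// UT_unitmx.
have UX : UT (A1 *m powmx P t) by apply: UT_mulmx => //; exact: powmx_UT.
split=> //.
- split=> [i|]; last by rewrite big_ord_recl big_ord1 /= /tnth /= subrK.
  by case: (unliftP ord0 i) => [j ->|->]; rewrite /tnth ?ord1//= subr_gt0.
- by move=> i; case: (unliftP ord0 i) => [j ->|->]; rewrite /tnth ?ord1.
(* Conversely [X^-1 A1 = P^(-t)] and [X^-1 A2 = P^(1-t)], whose weighted logarithms cancel. *)
rewrite sumE; have uX := UT_unitmx UX; have uP := UT_unitmx (powmx_UT t UP).
have XA1 : invmx (A1 *m powmx P t) *m A1 = powmx P (- t).
  by rewrite powmxN -[X in _ *m X = _](mulmxK uP) mulmxA mulVmx// mul1mx.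
have -> : invmx (A1 *m powmx P t) *m A2 = powmx P (1 - t).
  by rewrite addrC powmxD powmx1// -XA1 -mulmxA /P mulKVmx.
rewrite XA1 !logmx_powmx// !scalerA -scalerDl (_ : _ + _ = 0) ?scale0r//.
by ring.
Qed.

End Powers.

(** * Analytic matrix functions *)

Section AnalyticMatrix.
Variables (R : realType) (I : finType) (a : I -> R).

Definition analytic_mx m n (F : (I -> R) -> 'M[R]_(m, n)) :=
  forall i j, analytic_near a (fun x => F x i j).

Lemma near_common (T : finType) (P : T -> (I -> R) -> Prop) :
  (forall t, exists2 r : R, 0 < r & forall x, near_pt a r x -> P t x) ->
  exists2 r : R, 0 < r & forall x, near_pt a r x -> forall t, P t x.
Proof.
move=> h; suff [r r0 hr] : exists2 r : R, 0 < r & forall x, near_pt a r x ->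
    forall t, t \in enum T -> P t x.
  by exists r => // x xr t; apply: hr; rewrite ?mem_enum.
elim: (enum T) => [|t s [r r0 hr]]; first by exists 1.
have [q q0 hq] := h t; exists (Num.min r q); first by rewrite lt_min r0.
move=> x xm u; rewrite inE => /predU1P[->|us].
  by apply: hq; apply: near_pt_le xm; rewrite ge_min lexx orbT.
by apply: hr => //; apply: near_pt_le xm; rewrite ge_min lexx.
Qed.

Lemma analytic_mulmx m n p (F : _ -> 'M[R]_(m, n)) (G : _ -> 'M[R]_(n, p)) :
  analytic_mx F -> analytic_mx G -> analytic_mx (fun x => F x *m G x).
Proof.
move=> FA GA i j; apply: (@analytic_eq _ _ _ (fun x => \sum_k F x i k * G x k j)).
  by move=> x; rewrite mxE.
by apply: analytic_sum => k; exact: analytic_mul.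
Qed.

Lemma analytic_det n (F : _ -> 'M[R]_n) : analytic_mx F -> analytic_near a (fun x => \det (F x)).
Proof.
move=> FA; apply: analytic_sum => s; apply: analytic_scale; apply: analytic_prod => i; exact: FA.
Qed.

(** Cramer's rule. The polydisc is shrunk until the determinant cannot vanish, since [invmx] returns
    its argument on singular matrices. *)
Lemma analytic_invmx n (F : _ -> 'M[R]_n) : \det (F a) != 0 -> analytic_mx F ->
  analytic_mx (fun x => invmx (F x)).
Proof.
move=> d0 FA i j; have dA := analytic_det FA.
have n0 : 0 < `|\det (F a)| / 2 by rewrite divr_gt0 ?normr_gt0.
have [r r0 hr] := analytic_norm_le n0 dA.
apply: (@analytic_ext _ _ _ (fun x => (\det (F x))^-1 * (\adj (F x)) i j) _ r) => //.
  move=> x /hr xr; have dx : \det (F x) != 0.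
    apply/eqP => dx; move: xr; rewrite dx sub0r normrN => xr; lra.
  by rewrite /invmx unitmxE unitfE dx [RHS]mxE.
apply: analytic_mul; first exact: analytic_inv.
apply: (@analytic_eq _ _ _ (fun x => (-1) ^+ (j + i) * \det (row' j (col' i (F x))))).
  by move=> x; rewrite mxE.
apply: analytic_scale; apply: analytic_det => k l; apply: analytic_eq (FA (lift j k) (lift i l)) => x.
by rewrite !mxE.
Qed.

Lemma analytic_block m1 m2 n1 n2 (A : _ -> 'M[R]_(m1, n1)) (B : _ -> 'M[R]_(m1, n2))
    (C : _ -> 'M[R]_(m2, n1)) (D : _ -> 'M[R]_(m2, n2)) :
  analytic_mx A -> analytic_mx B -> analytic_mx C -> analytic_mx D ->
  analytic_mx (fun x => block_mx (A x) (B x) (C x) (D x)).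
Proof.
move=> AA BA CA DA i j.
case: (split_ordP i) => k ->; case: (split_ordP j) => l ->.
- by apply: analytic_eq (AA k l) => x; rewrite block_mxEul.
- by apply: analytic_eq (BA k l) => x; rewrite block_mxEur.
- by apply: analytic_eq (CA k l) => x; rewrite block_mxEdl.
- by apply: analytic_eq (DA k l) => x; rewrite block_mxEdr.
Qed.

Lemma analytic_mx_cst m n (A : 'M[R]_(m, n)) : analytic_mx (fun=> A).
Proof. by move=> i j; exact: analytic_cst. Qed.

Lemma analytic_scalar_mx n f : analytic_near a f -> analytic_mx (fun x => (f x)%:M : 'M[R]_n).
Proof.
move=> fA i j; apply: (@analytic_eq _ _ _ (fun x => (i == j)%:R * f x)).
  by move=> x; rewrite mxE mulr_natl.
exact: analytic_scale.
Qed.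

Lemma pseries_bigsum n (r N : R) (G : 'I_n -> (I -> R) -> R) : 0 < r ->
  (forall p, pseries_bound a r N (G p)) -> pseries_bound a r (n%:R * N) (fun x => \sum_p G p x).
Proof.
move=> r0; elim: n G => [|n IH] G GN.
  have := pseries_cst a 0 r0; rewrite normr0 mul0r.
  by apply: pseries_ext => x _; rewrite big_ord0.
have -> : n.+1%:R * N = N + n%:R * N by rewrite -add1n natrD mulrDl mul1r.
apply: pseries_ext (pseries_add (GN ord0) (IH _ (fun p => GN (lift ord0 p)))) => x _.
by rewrite big_ord_recl.
Qed.

(** If the entries of [F] have norm at most [M], those of [F ^ k] have norm at most [(n M)^k], and
    the exponential series converges at [n M]. *)
Lemma analytic_expmx n (F : _ -> 'M[R]_n) : analytic_mx F -> analytic_mx (fun x => expmx (F x)).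
Proof.
move=> FA i j.
have [r [M [r0 FM]]] := analytic_common (fun p : 'I_n * 'I_n => FA p.1 p.2).
have M0 : 0 <= M := pseries_ge0 (FM (i, j)).
pose c := n%:R * M; have c0 : 0 <= c by rewrite mulr_ge0.
have Fk k p q : pseries_bound a r (c ^+ k) (fun x => (F x ^+ k) p q).
  elim: k p q => [|k IH] p q.
    have := pseries_cst a ((1%:M : 'M[R]_n) p q) r0; rewrite expr0; apply: pseries_le.
    by rewrite mxE; case: (p == q); rewrite ?normr1 ?normr0.
  rewrite exprS /c -mulrA; apply: pseries_ext (pseries_bigsum r0
    (fun s => pseries_mul r0 (FM (p, s)) (IH s q))) => x _ /=.
  by rewrite exprSmx mxE.
have fin := nsum_exp_coeff c.
have finE : nsum (fun k => k`!%:R^-1 * c ^+ k)%R =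
    (fine (nsum (fun k => k`!%:R^-1 * c ^+ k)%R))%:E.
  by rewrite fineK// ge0_fin_numE// nsum_ge0.
exists r, (fine (nsum (fun k => k`!%:R^-1 * c ^+ k))); split=> //.
apply: (@pseries_sum _ _ _ _ (fun k x => k`!%:R^-1 * (F x ^+ k) i j)
  (fun k => `|k`!%:R^-1| * c ^+ k)) => //.
- by move=> k; apply: pseries_scale.
- rewrite -finE; apply: le_esum => k _.
  by rewrite lee_fin normrM (ger0_norm (exprn_ge0 _ c0)).
- by move=> x _; rewrite expmxE.
Qed.

Lemma analytic_phi n f (F : _ -> 'M[R]_n) : analytic_near a f -> analytic_mx F ->
  analytic_mx (fun x => divdiff_mx (f x) (F x)).
Proof.
move=> fA FA i j; have := analytic_expmx (analytic_block (analytic_scalar_mx (n := n) fA)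
  (analytic_mx_cst 1%:M) (analytic_mx_cst 0) FA) (lshift n i) (rshift n j).
by apply: analytic_eq => x; rewrite [RHS]mxE [RHS]mxE.
Qed.

(** The formula of [logmx_block] is applied at matrices of [UT], hence the hypothesis on a whole
    polydisc; its radius survives the induction because lower blocks stay in [UT]. *)
Lemma analytic_logmx n (F : _ -> 'M[R]_n) (r : R) : 0 < r ->
  (forall x, near_pt a r x -> UT (F x)) -> analytic_mx F ->
  analytic_mx (fun x => logmx (F x)).
Proof.
move=> r0; elim: n F => [|n IH] F FU FA; first by move=> [].
pose al x : R := F x ord0 ord0.
pose u x := ursubmx (F x : 'M[R]_(1 + n)).
pose B x := drsubmx (F x : 'M[R]_(1 + n)).
have FE x : near_pt a r x -> [/\ F x = block_mx (al x)%:M (u x) 0 (B x) :> 'M[R]_(1 + n),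
    0 < al x & UT (B x)].
  move=> /FU UF; have FE := ut_blockE (UF.1 : ut (F x : 'M[R]_(1 + n))).
  split=> //; first by have [_] := UF; apply.
  by move: UF; rewrite [F x]FE => /UT_block[].
have BA : analytic_mx B.
  by move=> i j; apply: analytic_eq (FA (rshift 1 i) (rshift 1 j)) => x; rewrite !mxE.
have uA : analytic_mx u.
  by move=> i j; apply: analytic_eq (FA (lshift n i) (rshift 1 j)) => x; rewrite !mxE.
have LBA : analytic_mx (fun x => logmx (B x)) by apply: IH => // x /FE[].
have [_ al0 UB] := FE a (near_pt_refl a r0).
have lnA : analytic_near a (fun x => ln (al x)) by apply: analytic_ln => //; exact: FA.
have [utLB _] := logmxP UB.
have LA := analytic_block (analytic_scalar_mx (n := 1) lnA)
  (analytic_mulmx uA (analytic_invmx (det_divdiff_neq0 (ln (al a)) utLB) (analytic_phi lnA LBA)))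
  (analytic_mx_cst 0) LBA.
move=> i j; apply: analytic_ext r0 _ (LA i j) => x /FE[FxE alx UBx].
have [utL EL] := logmxP UBx.
have [utX EX] := logmx_block (u x) alx utL EL.
by rewrite FxE (logmx_unique utX EX).
Qed.

End AnalyticMatrix.

(** * The mean as a function of the entries of both matrices *)

Lemma analytic_mx_of_entries (R : realType) n (J : finType) (e : utpos n -> J)
    (a : J -> R) : analytic_mx a (fun x => mx_of_entries (x \o e)).
Proof.
move=> i j; apply: (@analytic_eq _ _ _
  (fun x => if insub (i, j) is Some p then x (e p) else 0)).
  by move=> x; rewrite mxE.
by case: insub => [p|]; [exact: analytic_coord|exact: analytic_cst].
Qed.

Lemma ut_mx_of_entries (R : realType) n (x : utpos n -> R) : ut (mx_of_entries x).
Proof. by apply/utP => i j ji; rewrite mxE insubF//= leqNgt ji. Qed.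

(** Triangularity is built into [mx_of_entries], and positivity of finitely many diagonal entries is
    an open condition. In the application [e] is [inl] or [inr], selecting one matrix among the
    joint coordinates. *)
Lemma near_UT_mx_of_entries (R : realType) n (J : finType) (e : utpos n -> J)
    (a : J -> R) : UT (mx_of_entries (a \o e)) ->
  exists2 r : R, 0 < r &
    forall x, near_pt a r x -> UT (mx_of_entries (x \o e)).
Proof.
move=> [_ d0]; have [i|r r0 hr] :=
    @near_common _ _ a 'I_n (fun i x => 0 < mx_of_entries (x \o e) i i).
  have n0 : 0 < mx_of_entries (a \o e) i i / 2 by rewrite divr_gt0.
  have [r r0 hr] := analytic_norm_le n0 (analytic_mx_of_entries e a i i).
  exists r => // x /hr; have := d0 i.
  move: (mx_of_entries (a \o e) i i) (mx_of_entries (x \o e) i i) => p q p0.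
  by rewrite ler_norml => /andP[? _]; lra.
by exists r => // x /hr xr; split=> //; exact: ut_mx_of_entries.
Qed.

Lemma karcher_meanE (R : realType) n (t : R) (A1 A2 : 'M[R]_n) :
  0 < t -> t < 1 -> UT A1 -> UT A2 ->
  karcher_mean [tuple 1 - t; t] [tuple A1; A2] =
  A1 *m powmx (invmx A1 *m A2) t.
Proof.
move=> t0 t1 U1 U2; apply: xget_unique; first exact/karcher_mean_iff.
by move=> Y /karcher_mean_iff; apply.
Qed.

Lemma powmxM (R : realType) n (A : 'M[R]_n) (s t : R) : UT A ->
  powmx (powmx A s) t = powmx A (s * t).
Proof. by move=> UA; rewrite /powmx logmx_powmx// scalerA mulrC. Qed.

(** Meant for [S] the square root of [A1] and [P = A1^-1 A2]: the base of the power is then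
    [S P S^-1]. *)
Lemma powmx_sqrt_conj (R : realType) n (S P : 'M[R]_n) (t : R) : UT S -> UT P ->
  S *m powmx (invmx S *m (S *m S *m P) *m invmx S) t *m S = S *m S *m powmx P t.
Proof.
move=> US UP; have uS := UT_unitmx US.
by rewrite -!mulmxA (mulKmx uS) [X in powmx X](mulmxA) powmx_conj// mulmxKV.
Qed.

Theorem theorem2p4 (R : realType) (n : nat) (t : R) (t0 : 0 < t) (t1 : t < 1) :
  [/\ forall A1 A2 : 'M[R]_n, UT A1 -> UT A2 ->
        exists! X, is_karcher_mean [tuple 1 - t; t] [tuple A1; A2] X,
      forall i j : 'I_n,
        analytic_on
          [set x : utpos n + utpos n -> R |
             UT (mx_of_entries (x \o inl)) /\ UT (mx_of_entries (x \o inr))]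
          (fun x => karcher_mean [tuple 1 - t; t]
             [tuple mx_of_entries (x \o inl); mx_of_entries (x \o inr)] i j),
      forall A1 A2 : 'M[R]_n, UT A1 -> UT A2 ->
        let G := karcher_mean [tuple 1 - t; t] [tuple A1; A2] in
        [/\ G = powmx A1 (1 / 2)
                *m powmx (powmx A1 (- (1 / 2)) *m A2 *m powmx A1 (- (1 / 2))) t
                *m powmx A1 (1 / 2),
            G = A1 *m powmx (invmx A1 *m A2) t
          & G = powmx (A2 *m invmx A1) t *m A1]
    & forall A1 A2 : 'M[R]_n, UT A1 -> UT A2 ->
        geomean t A1 A2 = geomean (1 - t) A2 A1].
Proof.
have UTdiv (A B : 'M[R]_n) : UT A -> UT B -> UT (invmx A *m B).
  by move=> UA UB; apply: UT_mulmx => //; exact: UT_invmx.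
split.
- move=> A1 A2 U1 U2; exists (A1 *m powmx (invmx A1 *m A2) t); split.
    exact/karcher_mean_iff.
  by move=> Y /(karcher_mean_iff _ t0 t1 U1 U2).
- move=> i j a [U1 U2]; apply: analytic_near_at.
  have [r r0 hr] := near_UT_mx_of_entries U1.
  have [s s0 hs] := near_UT_mx_of_entries U2.
  pose q := Num.min r s; have q0 : 0 < q by rewrite lt_min r0.
  have near_UT x : near_pt a q x ->
      UT (mx_of_entries (x \o inl)) /\ UT (mx_of_entries (x \o inr)).
    move=> xq; split; [apply: hr|apply: hs]; apply: near_pt_le xq.
      by rewrite ge_min lexx.
    by rewrite ge_min lexx orbT.
  have AA := analytic_mx_of_entries (@inl (utpos n) (utpos n)) a.
  have AB := analytic_mx_of_entries (@inr (utpos n) (utpos n)) a.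
  have Ldiv : analytic_mx a (fun x => logmx
      (invmx (mx_of_entries (x \o inl)) *m mx_of_entries (x \o inr))).
    apply: (analytic_logmx q0) => [x /near_UT[Ux1 Ux2]|]; first exact: UTdiv.
    apply: analytic_mulmx => //; apply: analytic_invmx => //.
    by have := UT_unitmx U1; rewrite unitmxE unitfE.
  have SA : analytic_mx a (fun x => t *: logmx
      (invmx (mx_of_entries (x \o inl)) *m mx_of_entries (x \o inr))).
    by move=> k l; apply: analytic_eq (analytic_scale t (Ldiv k l)) => x; rewrite [RHS]mxE.
  (* The explicit formula represents the mean as long as both arguments stay in [UT], which holds on
     this polydisc. *)
  apply: analytic_ext q0 _ (analytic_mulmx AA (analytic_expmx SA) i j) => x /near_UT[Ux1 Ux2].
  by rewrite karcher_meanE.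
- move=> A1 A2 U1 U2 G; have u1 := UT_unitmx U1.
  have GE : G = A1 *m powmx (invmx A1 *m A2) t by exact: karcher_meanE.
  have A2E : A2 = A1 *m (invmx A1 *m A2) by rewrite mulKVmx.
  have UP := UTdiv _ _ U1 U2; move: (invmx A1 *m A2) GE A2E UP => P GE A2E UP.
  (* For the third formula, [A2 A1^-1] is [A1 P A1^-1]. *)
  split; [|exact: GE|by rewrite GE A2E powmx_conj// mulmxKV].
  have US := powmx_UT (1 / 2) U1.
  have SS : powmx A1 (1 / 2) *m powmx A1 (1 / 2) = A1.
    by rewrite -powmxD (_ : 1 / 2 + 1 / 2 = 1) ?powmx1//; field.
  have := powmx_sqrt_conj t US UP; rewrite SS => SPS.
  by rewrite GE A2E powmxN -SPS.
- move=> A1 A2 U1 U2; have t0' : 0 < 1 - t by rewrite subr_gt0.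
  have t1' : 1 - t < 1 by rewrite ltrBlDr ltrDl.
  rewrite /geomean (karcher_meanE t0 t1 U1 U2) (karcher_meanE t0' t1' U2 U1).
  have UP := UTdiv _ _ U1 U2; have uP := UT_unitmx UP.
  have A2E : A2 = A1 *m (invmx A1 *m A2) by rewrite mulKVmx// UT_unitmx.
  (* With [P = A1^-1 A2] the reversed quotient is [P^-1]; the right side becomes
     [A1 P P^(-(1 - t))], whose exponents add up to [t]. *)
  have -> : invmx A2 *m A1 = powmx (invmx A1 *m A2) (- 1).
    rewrite powmxN powmx1// -[LHS](mulmxK uP) mulmxA mulmxK ?UT_unitmx//.
    by rewrite mulVmx ?mul1mx// UT_unitmx.
  move: (invmx A1 *m A2) UP A2E {uP} => P UP ->; rewrite (powmxM _ _ UP).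
  rewrite -mulmxA -[X in _ = _ *m (X *m _)](powmx1 UP) -powmxD.
  by congr (_ *m powmx _ _); ring.
Qed.
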